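(* Let $E_{\mathcal G}\rightrightarrows E_M$ be a VB-groupoid of rank $(l,k)$ over a Lie groupoid $\mathcal G\rightrightarrows M$, with core $C$. Then the right Lie group actions of $\mathrm{GL}(l+k)$ on $\mathrm{Fr}(E_{\mathcal G})$ and of $\mathrm{GL}(l)\times\mathrm{GL}(k)$ on $\mathrm{Fr}(C)\times_M\mathrm{Fr}(E_M)$ (by precomposition) induce a canonical right free 2-action of the 2-groupoid $\mathrm{GL}(l,k)$ on the set-theoretical groupoid $\mathrm{Fr}^{\mathrm{sbis}}(E_{\mathcal G})\rightrightarrows\mathrm{Fr}(C)\times_M\mathrm{Fr}(E_M)$, with moment map $$\mu:\mathrm{Fr}^{\mathrm{sbis}}(E_{\mathcal G})\to\mathrm{GL}(l,k)_0,\qquad \phi_g\mapsto d_{\phi_g}.$$ More precisely, the right groupoid action of $\mathrm{GL}(l,k)_2\rightrightarrows\mathrm{GL}(l,k)_0$ on $\mathrm{Fr}^{\mathrm{sbis}}(E_{\mathcal G})$ is $$\phi_g\cdot\left(d,\begin{pmatrix}A&JB\\0&B\end{pmatrix}\right):=\phi_g\circ\begin{pmatrix}A&JB\\0&B\end{pmatrix}\qquad(d=d_{\phi_g}),$$ and the right groupoid action of $\mathrm{GL}(l,k)_1\rightrightarrows\mathrm{GL}(l,k)_0$ on $\mathrm{Fr}(C)\times_M\mathrm{Fr}(E_M)$ is $$(\varphi^c_x,\varphi^b_x)\cdot(d,A,B):=(\varphi^c_x\circ A,\ \varphi^b_x\circ B).$$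
   Context: VB-groupoid of rank $(l,k)$ over a Lie groupoid $\mathcal G\rightrightarrows M$ (source $s$, target $t$, product $gh$ defined when $s(g)=t(h)$, units $1_x$): a Lie groupoid $E_{\mathcal G}\rightrightarrows E_M$ with structure maps $\tilde s,\tilde t,\tilde m,\tilde u,\tilde\tau$ (source, target, multiplication, unit, inverse), together with vector bundles $E_{\mathcal G}\to\mathcal G$ of rank $l+k$ and $E_M\to M$ of rank $k$, such that all structure maps are vector bundle morphisms over those of $\mathcal G\rightrightarrows M$. A subscript $g$ denotes restriction to the fibre $(E_{\mathcal G})_g$. Core: $C:=\{e\in(E_{\mathcal G})_{1_x}: x\in M,\ \tilde s(e)=0\}$, a rank $l$ vector bundle over $M$, with core-anchor $\rho:=\tilde t|_C:C\to E_M$. Right translation: $\tilde R_g:=\tilde m(\cdot,0_g):\ker(\tilde s)|_{s^{-1}(t(g))}\to\ker(\tilde s)|_{s^{-1}(s(g))}$. $\mathrm{Fr}(E)$ is the frame bundle (linear isomorphisms $\mathbb R^r\to E_x$) of a rank $r$ vector bundle. An $s$-bisection frame is a frame $\phi_g:\mathbb R^l\times\mathbb R^k\to(E_{\mathcal G})_g$ such that (1) $\phi_g(\mathbb R^l\times\{0\})\subseteq\ker(\tilde s_g)$; (2) $H_g:=\phi_g(\{0\}\times\mathbb R^k)$ satisfies $H_g\oplus\ker(\tilde s_g)=(E_{\mathcal G})_g=H_g\oplus\ker(\tilde t_g)$. Their set is $\mathrm{Fr}^{\mathrm{sbis}}(E_{\mathcal G})$. With $\mathbf t(\phi_g)^b(v):=\tilde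 t(\phi_g(0,v))$ and $\mathbf t(\phi_g)^c(w):=\tilde R_{g^{-1}}(\phi_g(w,0))$ (frames of $E_M$ and $C$ at $t(g)$), set $d_{\phi_g}:=(\mathbf t(\phi_g)^b)^{-1}\circ\rho_{t(g)}\circ\mathbf t(\phi_g)^c:\mathbb R^l\to\mathbb R^k$. Groupoid structure on $\mathrm{Fr}^{\mathrm{sbis}}(E_{\mathcal G})\rightrightarrows\mathrm{Fr}(C)\times_M\mathrm{Fr}(E_M)$: source $\mathbf s(\phi_g)=(\mathbf s(\phi_g)^c,\mathbf s(\phi_g)^b)$ with $\mathbf s(\phi_g)^c(w)=\tilde R_g(\tilde\tau(\phi_g(-w,d_{\phi_g}(w))))$, $\mathbf s(\phi_g)^b(v)=\tilde s(\phi_g(0,v))$; target $\mathbf t(\phi_g)=(\mathbf t(\phi_g)^c,\mathbf t(\phi_g)^b)$; product $\mathbf m(\phi_g,\phi_h)(w,v)=\tilde m(\phi_g(0,v),\phi_h(0,v))+\tilde R_h(\phi_g(w,0))$; unit $\mathbf u(\varphi^c_x,\varphi^b_x)(w,v)=\tilde u(\varphi^b_x(v))+\varphi^c_x(w)$; inverse $\boldsymbol\tau(\phi_g)(w,v)=\tilde\tau(\phi_g(-w,v+d_{\phi_g}(w)))$. General linear 2-groupoid $\mathrm{GL}(l,k)$: $\mathrm{GL}(l,k)_0=\mathrm{Hom}(\mathbb R^l,\mathbb R^k)$; $\mathrm{GL}(l,k)_1=\mathrm{Hom}(\mathbb R^l,\mathbb R^k)\times\mathrm{GL}(l)\times\mathrm{GL}(k)$;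 $\mathrm{GL}(l,k)_2$ is the set of pairs $\left(d,\begin{pmatrix}A&JB\\0&B\end{pmatrix}\right)\in\mathrm{Hom}(\mathbb R^l,\mathbb R^k)\times\mathrm{GL}(l+k)$ with $I_l+Jd\in\mathrm{GL}(l)$ and $I_k+dJ\in\mathrm{GL}(k)$. Write $(d,A,J,B)$ for such a pair. Then $t_{10}(d,A,B)=d$, $s_{10}(d,A,B)=B^{-1}dA$, with product the matrix products (action groupoid of $d\cdot(A,B)=B^{-1}dA$); $t_{20}(d,A,J,B)=d$, $s_{20}(d,A,J,B)=((I+dJ)B)^{-1}dA$, with product over $\mathrm{GL}(l,k)_0$ given by the product of block matrices (keeping the $d$ of the first factor); $t_{21}(d,A,J,B)=(d,A,(I+dJ)B)$, $s_{21}(d,A,J,B)=(d,(I+Jd)^{-1}A,B)$, with product over $\mathrm{GL}(l,k)_1$: $(d,A,J,(I+dJ')B')\circ_{21}(d,(I+Jd)^{-1}A,J',B')=(d,A,JdJ'+J+J',B')$. (Right) 2-action of a 2-groupoid $\mathcal H_2\rightrightarrows\mathcal H_1\rightrightarrows\mathcal H_0$ on a groupoid $P_2\rightrightarrows P_1$ (source $\mathbf s$, target $\mathbf t$): maps $\mu_i:P_i\to\mathcal H_0$ and right groupoid actions of $\mathcal H_i\rightrightarrows\mathcal H_0$ on $P_i$ along $\mu_i$ ($p\cdot h$ defined iff $\mu_i(p)=t_{i0}(h)$, and $\mu_i(p\cdot h)=s_{i0}(h)$), such that $\mu_2=\mu_1\circ\mathbf s=\mu_1\circ\mathbf t$ and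 the two action maps form a groupoid morphism from $P_2\times_{\mathcal H_0}\mathcal H_2\rightrightarrows P_1\times_{\mathcal H_0}\mathcal H_1$ (with componentwise structure maps) to $P_2\rightrightarrows P_1$. It is free if both actions are free. Here $\mu_2=\mu$ and hence $\mu_1=\mu\circ\mathbf u$, i.e. $\mu_1(\varphi^c_x,\varphi^b_x)=(\varphi^b_x)^{-1}\circ\rho_x\circ\varphi^c_x$. At this stage everything is set-theoretical (no smoothness is claimed). *)

(* Defs.v *)
From mathcomp Require Import all_boot all_order all_algebra.
From mathcomp Require Import all_classical all_reals all_analysis.
Set Implicit Arguments.
Unset Strict Implicit.
Unset Printing Implicit Defensive.
Import Order.TTheory GRing.Theory Num.Theory.
Import numFieldNormedType.Exports.
Local Open Scope classical_set_scope.
Local Open Scope ring_scope.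

(** * Set-theoretical groupoids *)

(* The structure maps are total functions on the ambient types O and A; only
   their values on the sets of objects and arrows (and, for the product, on
   composable pairs) are meaningful. *)
Record gpd_ops (O A : Type) := GpdOps {
  gsrc : A -> O;
  gtgt : A -> O;
  gmul : A -> A -> A;
  gunit : O -> A;
  ginv : A -> A }.

Record sgpd (O A : Type) := SGpd {
  gobjs : set O;
  garrs : set A;
  gops :> gpd_ops O A }.

Definition full_gpd O A (G : gpd_ops O A) : sgpd O A := SGpd setT setT G.

Record is_groupoid O A (G : sgpd O A) : Prop := IsGroupoid {
  gsrc_in : forall a, garrs G a -> gobjs G (gsrc G a);
  gtgt_in : forall a, garrs G a -> gobjs G (gtgt G a);
  gmul_in : forall a b, garrs G a -> garrs G b -> gsrc G a = gtgt G b ->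
    garrs G (gmul G a b);
  gunit_in : forall x, gobjs G x -> garrs G (gunit G x);
  ginv_in : forall a, garrs G a -> garrs G (ginv G a);
  gsrc_mul : forall a b, garrs G a -> garrs G b -> gsrc G a = gtgt G b ->
    gsrc G (gmul G a b) = gsrc G b;
  gtgt_mul : forall a b, garrs G a -> garrs G b -> gsrc G a = gtgt G b ->
    gtgt G (gmul G a b) = gtgt G a;
  gmulA : forall a b c, garrs G a -> garrs G b -> garrs G c ->
    gsrc G a = gtgt G b -> gsrc G b = gtgt G c ->
    gmul G (gmul G a b) c = gmul G a (gmul G b c);
  gsrc_unit : forall x, gobjs G x -> gsrc G (gunit G x) = x;
  gtgt_unit : forall x, gobjs G x -> gtgt G (gunit G x) = x;
  gmul1l : forall a, garrs G a -> gmul G (gunit G (gtgt G a)) a = a;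
  gmul1r : forall a, garrs G a -> gmul G a (gunit G (gsrc G a)) = a;
  gsrc_inv : forall a, garrs G a -> gsrc G (ginv G a) = gtgt G a;
  gtgt_inv : forall a, garrs G a -> gtgt G (ginv G a) = gsrc G a;
  gmulV : forall a, garrs G a -> gmul G a (ginv G a) = gunit G (gtgt G a);
  gmulVl : forall a, garrs G a -> gmul G (ginv G a) a = gunit G (gsrc G a) }.

Record gpd_morphism O A O' A' (G : sgpd O A) (G' : sgpd O' A')
    (f0 : O -> O') (f1 : A -> A') : Prop := GpdMorphism {
  mor_obj : forall x, gobjs G x -> gobjs G' (f0 x);
  mor_arr : forall a, garrs G a -> garrs G' (f1 a);
  mor_src : forall a, garrs G a -> gsrc G' (f1 a) = f0 (gsrc G a);
  mor_tgt : forall a, garrs G a -> gtgt G' (f1 a) = f0 (gtgt G a);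
  mor_mul : forall a b, garrs G a -> garrs G b -> gsrc G a = gtgt G b ->
    f1 (gmul G a b) = gmul G' (f1 a) (f1 b);
  mor_unit : forall x, gobjs G x -> f1 (gunit G x) = gunit G' (f0 x);
  mor_inv : forall a, garrs G a -> f1 (ginv G a) = ginv G' (f1 a) }.

(* A fibred product of groupoids: componentwise structure maps, with the
   objects and arrows cut out by B0 and B1. *)
Definition fib_prod O A O' A' (B0 : set (O * O')) (B1 : set (A * A'))
    (G : gpd_ops O A) (G' : gpd_ops O' A') : sgpd (O * O') (A * A') :=
  SGpd B0 B1 (GpdOps
    (fun p => (gsrc G p.1, gsrc G' p.2))
    (fun p => (gtgt G p.1, gtgt G' p.2))
    (fun p q => (gmul G p.1 q.1, gmul G' p.2 q.2))
    (fun x => (gunit G x.1, gunit G' x.2))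
    (fun p => (ginv G p.1, ginv G' p.2))).

(** * 2-groupoids and their right 2-actions *)

(* H10, H20, H21 are the groupoids H_1 => H_0, H_2 => H_0, H_2 => H_1. *)
Record two_gpd_data (T0 T1 T2 : Type) := TwoGpdData {
  H0 : set T0;
  H1 : set T1;
  H2 : set T2;
  ops10 : gpd_ops T0 T1;
  ops20 : gpd_ops T0 T2;
  ops21 : gpd_ops T1 T2 }.

Definition H10 T0 T1 T2 (H : two_gpd_data T0 T1 T2) := SGpd (H0 H) (H1 H) (ops10 H).
Definition H20 T0 T1 T2 (H : two_gpd_data T0 T1 T2) := SGpd (H0 H) (H2 H) (ops20 H).
Definition H21 T0 T1 T2 (H : two_gpd_data T0 T1 T2) := SGpd (H1 H) (H2 H) (ops21 H).

(* two_interchange says that the products over H_0 form a groupoid morphism from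
   H_2 x_{H_0} H_2 => H_1 x_{H_0} H_1 to H_2 => H_1. *)
Record is_two_groupoid T0 T1 T2 (H : two_gpd_data T0 T1 T2) : Prop :=
  IsTwoGroupoid {
  two_gpd10 : is_groupoid (H10 H);
  two_gpd20 : is_groupoid (H20 H);
  two_gpd21 : is_groupoid (H21 H);
  two_src_src : forall a, H2 H a ->
    gsrc (ops10 H) (gsrc (ops21 H) a) = gsrc (ops20 H) a;
  two_src_tgt : forall a, H2 H a ->
    gsrc (ops10 H) (gtgt (ops21 H) a) = gsrc (ops20 H) a;
  two_tgt_src : forall a, H2 H a ->
    gtgt (ops10 H) (gsrc (ops21 H) a) = gtgt (ops20 H) a;
  two_tgt_tgt : forall a, H2 H a ->
    gtgt (ops10 H) (gtgt (ops21 H) a) = gtgt (ops20 H) a;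
  two_unit : forall d, H0 H d ->
    gunit (ops21 H) (gunit (ops10 H) d) = gunit (ops20 H) d;
  two_interchange : gpd_morphism
    (fib_prod
      [set p | [/\ H1 H p.1, H1 H p.2 & gsrc (ops10 H) p.1 = gtgt (ops10 H) p.2]]
      [set p | [/\ H2 H p.1, H2 H p.2 & gsrc (ops20 H) p.1 = gtgt (ops20 H) p.2]]
      (ops21 H) (ops21 H))
    (H21 H)
    (fun p => gmul (ops10 H) p.1 p.2) (fun p => gmul (ops20 H) p.1 p.2) }.

Record right_action X A T (G : sgpd X A) (P : set T) (mu : T -> X)
    (act : T -> A -> T) : Prop := RightAction {
  act_moment : forall p, P p -> gobjs G (mu p);
  act_in : forall p h, P p -> garrs G h -> mu p = gtgt G h -> P (act p h);
  act_mu : forall p h, P p -> garrs G h -> mu p = gtgt G h ->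
    mu (act p h) = gsrc G h;
  act_unit : forall p, P p -> act p (gunit G (mu p)) = p;
  act_mul : forall p h h', P p -> garrs G h -> garrs G h' ->
    mu p = gtgt G h -> gsrc G h = gtgt G h' ->
    act (act p h) h' = act p (gmul G h h') }.

Definition free_action X A T (G : sgpd X A) (P : set T) (mu : T -> X)
    (act : T -> A -> T) : Prop :=
  forall p h, P p -> garrs G h -> mu p = gtgt G h -> act p h = p ->
    h = gunit G (mu p).

Record right_two_action T0 T1 T2 X1 X2 (H : two_gpd_data T0 T1 T2)
    (P : sgpd X1 X2) (mu1 : X1 -> T0) (mu2 : X2 -> T0)
    (act1 : X1 -> T1 -> X1) (act2 : X2 -> T2 -> X2) : Prop := RightTwoAction {
  tact_two_groupoid : is_two_groupoid H;
  tact_groupoid : is_groupoid P;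
  tact_act1 : right_action (H10 H) (gobjs P) mu1 act1;
  tact_act2 : right_action (H20 H) (garrs P) mu2 act2;
  tact_mu_src : forall p, garrs P p -> mu2 p = mu1 (gsrc P p);
  tact_mu_tgt : forall p, garrs P p -> mu2 p = mu1 (gtgt P p);
  tact_morphism : gpd_morphism
    (fib_prod
      [set q | [/\ gobjs P q.1, H1 H q.2 & mu1 q.1 = gtgt (ops10 H) q.2]]
      [set q | [/\ garrs P q.1, H2 H q.2 & mu2 q.1 = gtgt (ops20 H) q.2]]
      P (ops21 H))
    P
    (fun q => act1 q.1 q.2) (fun q => act2 q.1 q.2) }.

Definition free_two_action T0 T1 T2 X1 X2 (H : two_gpd_data T0 T1 T2)
    (P : sgpd X1 X2) (mu1 : X1 -> T0) (mu2 : X2 -> T0)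
    (act1 : X1 -> T1 -> X1) (act2 : X2 -> T2 -> X2) : Prop :=
  free_action (H10 H) (gobjs P) mu1 act1 /\
  free_action (H20 H) (garrs P) mu2 act2.

(** * Smooth manifolds, Lie groupoids, vector bundles *)

(* A manifold is a bare type with an atlas, which also determines the topology
   (atlas_open). *)

Section Smooth.
Variable R : realType.

Fixpoint Ck (j n m : nat) (W : set 'rV[R]_n) (f : 'rV[R]_n -> 'rV[R]_m) : Prop :=
  (forall x, W x -> {for x, continuous f}) /\
  match j with
  | 0 => True
  | j'.+1 => forall v : 'rV[R]_n,
      (forall x, W x -> derivable f x v) /\ Ck j' W (fun x => 'D_v f x)
  end.

Definition smooth_on n m (W : set 'rV[R]_n) (f : 'rV[R]_n -> 'rV[R]_m) : Prop :=
  forall j, Ck j W f.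

Record chart (X : Type) := Chart {
  cdim : nat;
  cdom : set X;
  cmap : X -> 'rV[R]_cdim }.

(* f, restricted to S, is g in the charts c and d near x: the coordinate of f y
   is g applied to that of y.  For S not open, g is a local smooth extension
   (the notion of smoothness for the inclusion of an embedded submanifold). *)
Definition local_rep X Y (S : set X) (f : X -> Y) (c : chart X) (d : chart Y)
    (x : X) (W : set 'rV[R]_(cdim c)) (g : 'rV[R]_(cdim c) -> 'rV[R]_(cdim d)) :
    Prop :=
  [/\ cdom c x, open W, W (cmap c x), smooth_on W g &
      forall y, S y -> cdom c y -> W (cmap c y) ->
        cdom d (f y) /\ cmap d (f y) = g (cmap c y)].

Record is_atlas X (A : set (chart X)) : Prop := IsAtlas {
  atlas_cover : forall x, exists2 c, A c & cdom c x;
  atlas_inj : forall c, A c -> set_inj (cdom c) (cmap c);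
  atlas_im_open : forall c, A c -> open (cmap c @` cdom c);
  atlas_compat : forall c d x, A c -> A d -> cdom c x -> cdom d x ->
    exists W g, @local_rep X X setT id c d x W g }.

Definition atlas_open X (A : set (chart X)) (U : set X) : Prop :=
  forall c, A c -> open (cmap c @` (cdom c `&` U)).

Definition atlas_hausdorff X (A : set (chart X)) : Prop :=
  forall x y, x <> y -> exists U V : set X,
    [/\ atlas_open A U, atlas_open A V, U x, V y & U `&` V = set0].

Definition atlas_second_countable X (A : set (chart X)) : Prop :=
  exists B, [/\ B `<=` A, countable B & forall x, exists2 c, B c & cdom c x].

Definition smooth_map X Y (A : set (chart X)) (B : set (chart Y)) (S : set X)
    (f : X -> Y) : Prop :=
  forall x, S x -> exists c d W g,
    [/\ A c, B d & @local_rep X Y S f c d x W g].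

Definition submersion X Y (A : set (chart X)) (B : set (chart Y)) (f : X -> Y) :
    Prop :=
  forall x, exists c d W g,
    [/\ A c, B d, @local_rep X Y setT f c d x W g &
        forall u, exists v, 'D_v g (cmap c x) = u].

Definition prod_chart X Y (c : chart X) (d : chart Y) : chart (X * Y) :=
  Chart (cdom c `*` cdom d) (fun p => row_mx (cmap c p.1) (cmap d p.2)).

Definition prod_atlas X Y (A : set (chart X)) (B : set (chart Y)) :
    set (chart (X * Y)) :=
  [set prod_chart c d | c in A & d in B].

Definition vec_atlas (r : nat) : set (chart 'rV[R]_r) :=
  [set Chart setT (fun v : 'rV[R]_r => v)].

(* The space of arrows of a Lie groupoid is not required to be Hausdorff or
   second countable. *)
Record lie_groupoid O A (AO : set (chart O)) (AA : set (chart A))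
    (G : gpd_ops O A) : Prop := LieGroupoid {
  lie_gpd : is_groupoid (full_gpd G);
  lie_obj_atlas : is_atlas AO;
  lie_obj_hausdorff : atlas_hausdorff AO;
  lie_obj_second_countable : atlas_second_countable AO;
  lie_arr_atlas : is_atlas AA;
  lie_src : submersion AA AO (gsrc G);
  lie_tgt : submersion AA AO (gtgt G);
  lie_mul : smooth_map (prod_atlas AA AA) AA
    [set p | gsrc G p.1 = gtgt G p.2] (fun p => gmul G p.1 p.2);
  lie_unit : smooth_map AO AA setT (gunit G);
  lie_inv : smooth_map AA AA setT (ginv G) }.

(* psi and th are mutually inverse trivializations over U of a bundle with
   fibres E b and total space {b & E b}. *)
Definition vector_bundle (r : nat) B (AB : set (chart B)) (E : B -> vectType R)
    (AE : set (chart {b : B & E b})) : Prop :=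
  is_atlas AE /\
  forall b0, exists (U : set B) (psi : forall b, E b -> 'rV[R]_r)
      (th : forall b, 'rV[R]_r -> E b),
    [/\ atlas_open AB U, U b0,
        forall b, U b -> [/\ linear (psi b), cancel (psi b) (th b)
                           & cancel (th b) (psi b)],
        smooth_map AE (prod_atlas AB (@vec_atlas r)) [set e | U (tag e)]
          (fun e => (tag e, psi (tag e) (tagged e)))
      & smooth_map (prod_atlas AB (@vec_atlas r)) AE [set p | U p.1]
          (fun p => Tagged (fun b => E b) (th p.1 p.2))].

End Smooth.

(** * VB-groupoids *)

(* The groupoid E_G => E_M on total spaces given by structure maps which cover
   those of G => M fibrewise. *)
Definition total_ops (R : realType) O A (G : gpd_ops O A)
    (EM : O -> vectType R) (EG : A -> vectType R)
    (st : forall g, EG g -> EM (gsrc G g))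
    (tt : forall g, EG g -> EM (gtgt G g))
    (mt : forall g h, EG g -> EG h -> EG (gmul G g h))
    (ut : forall x, EM x -> EG (gunit G x))
    (it : forall g, EG g -> EG (ginv G g)) :
    gpd_ops {x : O & EM x} {g : A & EG g} :=
  GpdOps
    (fun e => Tagged (fun x => EM x) (st (tag e) (tagged e)))
    (fun e => Tagged (fun x => EM x) (tt (tag e) (tagged e)))
    (fun e f => Tagged (fun g => EG g) (mt (tag e) (tag f) (tagged e) (tagged f)))
    (fun v => Tagged (fun g => EG g) (ut (tag v) (tagged v)))
    (fun e => Tagged (fun g => EG g) (it (tag e) (tagged e))).

(* As for gpd_ops, vmul g h e f is meaningful only for composable e and f;
   vmul_linear is linearity on the fibres of the fibred product of E_G with
   itself over E_M. *)
Record vb_groupoid (R : realType) (l k : nat) := VBGroupoid {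
  Mtype : Type;
  Gtype : Type;
  G0 : gpd_ops Mtype Gtype;
  M_atlas : set (chart R Mtype);
  G_atlas : set (chart R Gtype);
  G_lie : lie_groupoid M_atlas G_atlas G0;
  EM : Mtype -> vectType R;
  EG : Gtype -> vectType R;
  vsrc : forall g, {linear EG g -> EM (gsrc G0 g)};
  vtgt : forall g, {linear EG g -> EM (gtgt G0 g)};
  vmul : forall g h, EG g -> EG h -> EG (gmul G0 g h);
  vunit : forall x, {linear EM x -> EG (gunit G0 x)};
  vinv : forall g, {linear EG g -> EG (ginv G0 g)};
  EM_atlas : set (chart R {x : Mtype & EM x});
  EG_atlas : set (chart R {g : Gtype & EG g});
  EM_bundle : vector_bundle k M_atlas EM_atlas;
  EG_bundle : vector_bundle (l + k) G_atlas EG_atlas;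
  vmul_linear : forall g h (e e' : EG g) (f f' : EG h) (a : R),
    gsrc G0 g = gtgt G0 h ->
    Tagged (fun x => EM x) (vsrc g e) = Tagged (fun x => EM x) (vtgt h f) ->
    Tagged (fun x => EM x) (vsrc g e') = Tagged (fun x => EM x) (vtgt h f') ->
    vmul (a *: e + e') (a *: f + f') = a *: vmul e f + vmul e' f';
  E_lie : lie_groupoid EM_atlas EG_atlas
    (total_ops (fun g => vsrc g) (fun g => vtgt g) vmul
       (fun x => vunit x) (fun g => vinv g)) }.

Arguments EM {R l k} v _.
Arguments EG {R l k} v _.
Arguments vsrc {R l k} v g.
Arguments vtgt {R l k} v g.
Arguments vmul {R l k} v {g h} _ _.
Arguments vunit {R l k} v x.
Arguments vinv {R l k} v g.

(** * Frames *)

(* R^n is 'cV[R]_n, Hom(R^l, R^k) is 'M[R]_(k, l) acting by left multiplication,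
   and (w, v) in R^l x R^k is col_mx w v. *)

(* linear isomorphisms from R^n onto the subspace S of V *)
Definition is_frame (R : realType) (n : nat) (V : vectType R) (S : set V)
    (phi : 'cV[R]_n -> V) : Prop :=
  [/\ linear phi, injective phi & range phi = S].

Definition precomp (R : realType) (n : nat) (V : vectType R)
    (phi : 'cV[R]_n -> V) (M : 'M[R]_n) : 'cV[R]_n -> V :=
  fun x => phi (M *m x).

Definition mx_of (R : realType) (l k : nat) (f : 'cV[R]_l -> 'cV[R]_k) :
    'M[R]_(k, l) :=
  \matrix_(i, j) f (delta_mx j 0) i 0.

Section Frames.
Variables (R : realType) (l k : nat) (E : vb_groupoid R l k).

Local Notation G := (G0 E).
Local Notation "1_ x" := (gunit G x) (at level 2, x at level 2, format "1_ x").

Definition baseG : is_groupoid (full_gpd G) := lie_gpd (G_lie E).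

Lemma tgt_unitG (x : Mtype E) : gtgt G 1_x = x.
Proof. exact: (gtgt_unit baseG). Qed.
Lemma mulVG (g : Gtype E) : gmul G g (ginv G g) = 1_(gtgt G g).
Proof. exact: (gmulV baseG). Qed.
Lemma mulVlG (g : Gtype E) : gmul G (ginv G g) g = 1_(gsrc G g).
Proof. exact: (gmulVl baseG). Qed.

Definition castEM x y (p : x = y) (v : EM E x) : EM E y :=
  eq_rect x (fun z => EM E z : Type) v y p.
Definition castEG g h (p : g = h) (e : EG E g) : EG E h :=
  eq_rect g (fun z => EG E z : Type) e h p.

Definition core (x : Mtype E) : set (EG E 1_x) := [set e | vsrc E 1_x e = 0].

Definition core_anchor (x : Mtype E) (c : EG E 1_x) : EM E x :=
  castEM (tgt_unitG x) (vtgt E 1_x c).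

(* Rtr h e is right translation of e by h, i.e. the product of e and 0_h *)
Definition Rtr (h : Gtype E) (g : Gtype E) (e : EG E g) : EG E (gmul G g h) :=
  vmul E e (0 : EG E h).

(* Fr(C) x_M Fr(E_M) inside an ambient type of pairs of maps *)
Definition preframe0 : Type :=
  {x : Mtype E & (('cV[R]_l -> EG E 1_x) * ('cV[R]_k -> EM E x))%type}.

Definition mkframe0 x (phic : 'cV[R]_l -> EG E 1_x) (phib : 'cV[R]_k -> EM E x) :
  preframe0 :=
  existT (fun x => (('cV[R]_l -> EG E 1_x) * ('cV[R]_k -> EM E x))%type)
    x (phic, phib).

Definition frames0 : set preframe0 :=
  [set p | is_frame (@core (tag p)) (tagged p).1 /\ is_frame setT (tagged p).2].

Definition preframe1 : Type := {g : Gtype E & 'cV[R]_(l + k) -> EG E g}.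

Definition mkframe1 g (phi : 'cV[R]_(l + k) -> EG E g) : preframe1 :=
  existT (fun g => 'cV[R]_(l + k) -> EG E g) g phi.

Definition Fr_EG : set preframe1 := [set phi | is_frame setT (tagged phi)].

Definition fr (phi : preframe1) (w : 'cV[R]_l) (v : 'cV[R]_k) : EG E (tag phi) :=
  tagged phi (col_mx w v).

Definition Hspace (phi : preframe1) : {vspace EG E (tag phi)} :=
  limg (linfun (fr phi 0)).

Definition Fr_sbis : set preframe1 :=
  [set phi | let g := tag phi in
    let ks := lker (linfun (vsrc E g)) in
    let kt := lker (linfun (vtgt E g)) in
    [/\ Fr_EG phi,
        forall w, vsrc E g (fr phi w 0) = 0,
        (Hspace phi + ks = fullv /\ Hspace phi :&: ks = 0)%VS
      & (Hspace phi + kt = fullv /\ Hspace phi :&: kt = 0)%VS]].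

(* mu_1 (phi^c_x, phi^b_x) = (phi^b_x)^-1 o rho_x o phi^c_x *)
Definition mu1 (p : preframe0) : 'M[R]_(k, l) :=
  mx_of ((linfun (tagged p).2)^-1%VF \o @core_anchor (tag p) \o (tagged p).1).

Definition tgt_c (phi : preframe1) (w : 'cV[R]_l) : EG E 1_(gtgt G (tag phi)) :=
  castEG (mulVG (tag phi)) (Rtr (ginv G (tag phi)) (fr phi w 0)).

Definition tgt_b (phi : preframe1) (v : 'cV[R]_k) : EM E (gtgt G (tag phi)) :=
  vtgt E (tag phi) (fr phi 0 v).

Definition fr_tgt (phi : preframe1) : preframe0 := mkframe0 (tgt_c phi) (tgt_b phi).

(* phi_g |-> d_(phi_g) *)
Definition mu (phi : preframe1) : 'M[R]_(k, l) := mu1 (fr_tgt phi).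

Definition src_c (phi : preframe1) (w : 'cV[R]_l) : EG E 1_(gsrc G (tag phi)) :=
  castEG (mulVlG (tag phi))
    (Rtr (tag phi) (vinv E (tag phi) (fr phi (- w) (mu phi *m w)))).

Definition src_b (phi : preframe1) (v : 'cV[R]_k) : EM E (gsrc G (tag phi)) :=
  vsrc E (tag phi) (fr phi 0 v).

Definition fr_src (phi : preframe1) : preframe0 := mkframe0 (src_c phi) (src_b phi).

Definition fr_mul (phi psi : preframe1) : preframe1 :=
  mkframe1 (fun x => let w := usubmx x in let v := dsubmx x in
    vmul E (fr phi 0 v) (fr psi 0 v) + Rtr (tag psi) (fr phi w 0)).

Definition fr_unit (p : preframe0) : preframe1 :=
  mkframe1 (fun x => let w := usubmx x in let v := dsubmx x in
    vunit E (tag p) ((tagged p).2 v) + (tagged p).1 w).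

Definition fr_inv (phi : preframe1) : preframe1 :=
  mkframe1 (fun x => let w := usubmx x in let v := dsubmx x in
    vinv E (tag phi) (fr phi (- w) (v + mu phi *m w))).

Definition Fr_sbis_gpd : sgpd preframe0 preframe1 :=
  SGpd frames0 Fr_sbis (GpdOps fr_src fr_tgt fr_mul fr_unit fr_inv).

Definition fr_act1 (p : preframe0) (h : 'M[R]_(k, l) * 'M[R]_l * 'M[R]_k) :
    preframe0 :=
  mkframe0 (precomp (tagged p).1 h.1.2) (precomp (tagged p).2 h.2).

Definition fr_act2 (phi : preframe1) (h : 'M[R]_(k, l) * 'M[R]_(l + k)) :
    preframe1 :=
  mkframe1 (precomp (tagged phi) h.2).

End Frames.

(** * The general linear 2-groupoid *)

Section GL.
Variables (R : realType) (l k : nat).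

Definition GL0 : Type := 'M[R]_(k, l).
Definition preGL1 : Type := ('M[R]_(k, l) * 'M[R]_l * 'M[R]_k)%type.
Definition preGL2 : Type := ('M[R]_(k, l) * 'M[R]_(l + k))%type.

Definition GL1_set : set preGL1 :=
  [set h | h.1.2 \in unitmx /\ h.2 \in unitmx].

Definition gl2 (d : 'M[R]_(k, l)) (A : 'M[R]_l) (J : 'M[R]_(l, k)) (B : 'M[R]_k) :
    preGL2 :=
  (d, block_mx A (J *m B) 0 B).

Definition GL2_set : set preGL2 :=
  [set h | exists d A J B,
    [/\ h = gl2 d A J B, h.2 \in unitmx,
        1%:M + J *m d \in unitmx & 1%:M + d *m J \in unitmx]].

(* the coordinates (d, A, J, B) of an element of GL2_set *)
Definition dpart (h : preGL2) : 'M[R]_(k, l) := h.1.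
Definition Apart (h : preGL2) : 'M[R]_l := ulsubmx h.2.
Definition Bpart (h : preGL2) : 'M[R]_k := drsubmx h.2.
Definition Jpart (h : preGL2) : 'M[R]_(l, k) := ursubmx h.2 *m invmx (Bpart h).

Definition GL_ops10 : gpd_ops GL0 preGL1 := GpdOps
  (fun h => let: (d, A, B) := h in invmx B *m d *m A)
  (fun h => h.1.1)
  (fun h h' => (h.1.1, h.1.2 *m h'.1.2, h.2 *m h'.2))
  (fun d => (d, 1%:M, 1%:M))
  (fun h => let: (d, A, B) := h in (invmx B *m d *m A, invmx A, invmx B)).

Definition GL_src20 (h : preGL2) : GL0 :=
  invmx ((1%:M + dpart h *m Jpart h) *m Bpart h) *m dpart h *m Apart h.

Definition GL_ops20 : gpd_ops GL0 preGL2 := GpdOps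
  GL_src20
  dpart
  (fun h h' => (h.1, h.2 *m h'.2))
  (fun d => (d, 1%:M))
  (fun h => (GL_src20 h, invmx h.2)).

Definition GL_src21 (h : preGL2) : preGL1 :=
  (dpart h, invmx (1%:M + Jpart h *m dpart h) *m Apart h, Bpart h).

Definition GL_tgt21 (h : preGL2) : preGL1 :=
  (dpart h, Apart h, (1%:M + dpart h *m Jpart h) *m Bpart h).

(* In GL_ops21 the J-component of the inverse solves J d J' + J + J' = 0. *)
Definition GL_ops21 : gpd_ops preGL1 preGL2 := GpdOps
  GL_src21
  GL_tgt21
  (fun h h' => gl2 (dpart h) (Apart h)
     (Jpart h *m dpart h *m Jpart h' + Jpart h + Jpart h') (Bpart h'))
  (fun h => gl2 h.1.1 h.1.2 0 h.2)
  (fun h => let: (d, A, B) := GL_src21 h in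
     gl2 d A (- (invmx (1%:M + Jpart h *m d) *m Jpart h))
       ((1%:M + d *m Jpart h) *m B)).

Definition GL_two_gpd : two_gpd_data GL0 preGL1 preGL2 :=
  TwoGpdData setT GL1_set GL2_set GL_ops10 GL_ops20 GL_ops21.

End GL.

(* Main.v *)
From HB Require Import structures.
Require Import Defs.
From mathcomp Require Import all_boot all_order all_algebra.
From mathcomp Require Import all_classical all_reals all_analysis.
Set Implicit Arguments.
Unset Strict Implicit.
Unset Printing Implicit Defensive.
Import GRing.Theory.
(* EM is to be the bundle over M, not the excluded middle *)
Import Defs.
Local Open Scope classical_set_scope.
Local Open Scope ring_scope.

(** Given [d : R^l -> R^k], let [V_d] be the groupoid with objects [R^k], arrows
    [(w, v)] in [R^l x R^k], source [v] and target [v + d w].  A pair of frames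
    [(c, b)] of the core and of E_M at x with moment [d], that is with
    [b o d = rho o c], is the same thing as a linear isomorphism from [V_d] to
    the groupoid formed by the fibres of E over x and its unit.  From this
    point of view an s-bisection frame [phi] over g with [mu phi = d] is a linear
    natural transformation [v |-> phi(0, v)] between its source and target frame
    pairs; [phi(w, 0)] is nothing but the core part [t(phi)^c] of the target
    pair, translated from the unit at t(g) to g.  The groupoid of frames composes
    natural transformations, and GL(l, k) acts by composing with isomorphisms
    between the groupoids [V_d] and natural transformations between these.

    Two formulas carry the proof of the groupoid laws.  By linearity of the
    multiplication of E (interchange) the product of composable frames is the
    pointwise product [(phi psi)(w, v) = phi(w, v) . psi(0, v)], lemma
    [fr_mul_vmul], so that the laws for products are those of E.  Naturality is
    the identity [phi(- y, d y) . psi(y, 0) = 0], lemma [exchange]; it gives the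
    source of a product.  Closure of the set of frames under all
    operations reduces to formulas for target frame pairs, because of the
    criterion [Fr_sbisP]: a map [phi], linear and with [phi(w, 0)] in the kernel of
    the source, is an s-bisection frame as soon as its target pair is a pair of
    frames and its base source map is injective.  Counting dimensions in the
    fibres of E_M, which have dimension k, replaces the surjectivity conditions.

    For the action of [h = (d, A, J, B)] on [phi], everything about sources follows
    from [A' = (1 + J d)^-1 A], for which [A = A' + J d A'], and from
    [B d' = d A'], where d' is the moment of [phi . h]: they give
    [(phi . h)(- w, d' w) = phi(- A' w, d A' w)], lemma [fr_act2_cross].  The action
    is compatible with products (lemma [fr_mul_act]) because the two sides
    differ by a value of the form [phi(y, - d y) . psi(- y, 0)].

    Elements of fibres over base points which are equal only by the groupoid
    axioms have different types.  They are therefore compared as points of the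
    total spaces, where the transports along these equalities become invisible
    and the axioms of the groupoid E hold. *)

(** * Groupoids *)

Section GroupoidLemmas.
Variables (O A : Type) (G : sgpd O A).
Hypothesis GG : is_groupoid G.

Lemma ginv_uniq a b : garrs G a -> garrs G b -> gsrc G a = gtgt G b ->
  gmul G a b = gunit G (gtgt G a) -> b = ginv G a.
Proof.
move=> Ga Gb sab ab1; have Ga' := ginv_in GG Ga.
have sa'a : gsrc G (ginv G a) = gtgt G a by rewrite (gsrc_inv GG).
rewrite -(gmul1l GG Gb) -sab -(gmulVl GG) // (gmulA GG) // ab1 -sa'a.
by rewrite (gmul1r GG).
Qed.

End GroupoidLemmas.

(** The base groupoid and the total groupoid have all elements of the ambient
    types as objects and arrows, so their laws have only composability
    conditions. *)
Section FullGroupoid.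
Variables (O A : Type) (G : gpd_ops O A).
Hypothesis GG : is_groupoid (full_gpd G).

Lemma fsrc_mul a b : gsrc G a = gtgt G b -> gsrc G (gmul G a b) = gsrc G b.
Proof. exact: (gsrc_mul GG I I). Qed.
Lemma ftgt_mul a b : gsrc G a = gtgt G b -> gtgt G (gmul G a b) = gtgt G a.
Proof. exact: (gtgt_mul GG I I). Qed.
Lemma fsrc_inv a : gsrc G (ginv G a) = gtgt G a.
Proof. exact: (gsrc_inv GG I). Qed.
Lemma ftgt_inv a : gtgt G (ginv G a) = gsrc G a.
Proof. exact: (gtgt_inv GG I). Qed.
Lemma fsrc_unit x : gsrc G (gunit G x) = x.
Proof. exact: (gsrc_unit GG I). Qed.
Lemma ftgt_unit x : gtgt G (gunit G x) = x.
Proof. exact: (gtgt_unit GG I). Qed.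
Lemma fmulV a : gmul G a (ginv G a) = gunit G (gtgt G a).
Proof. exact: (gmulV GG I). Qed.
Lemma fmulVl a : gmul G (ginv G a) a = gunit G (gsrc G a).
Proof. exact: (gmulVl GG I). Qed.
Lemma fmul1l a x : x = gtgt G a -> gmul G (gunit G x) a = a.
Proof. by move=> ->; exact: (gmul1l GG I). Qed.
Lemma fmul1r a x : x = gsrc G a -> gmul G a (gunit G x) = a.
Proof. by move=> ->; exact: (gmul1r GG I). Qed.
Lemma fmulA a b c : gsrc G a = gtgt G b -> gsrc G b = gtgt G c ->
  gmul G (gmul G a b) c = gmul G a (gmul G b c).
Proof. exact: (gmulA GG I I I). Qed.

Lemma fginvK a : ginv G (ginv G a) = a.
Proof.
apply/esym/(@ginv_uniq _ _ (full_gpd G)) => //=; first by rewrite fsrc_inv.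
by rewrite fmulVl ftgt_inv.
Qed.

Lemma fmulK a b : gsrc G a = gtgt G b -> gmul G (gmul G a b) (ginv G b) = a.
Proof. by move=> ab; rewrite fmulA ?ftgt_inv // fmulV fmul1r. Qed.

Lemma fmulVK a b : gsrc G a = gsrc G b -> gmul G (gmul G a (ginv G b)) b = a.
Proof. by move=> ab; rewrite fmulA ?ftgt_inv ?fsrc_inv // fmulVl fmul1r. Qed.

Lemma fginv_mul a b : gsrc G a = gtgt G b ->
  ginv G (gmul G a b) = gmul G (ginv G b) (ginv G a).
Proof.
move=> ab; have vv : gsrc G (ginv G b) = gtgt G (ginv G a).
  by rewrite fsrc_inv ftgt_inv.
apply/esym/(@ginv_uniq _ _ (full_gpd G)) => //=.
  by rewrite fsrc_mul // ftgt_mul // ftgt_inv.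
have sV : gsrc G (gmul G a b) = gtgt G (ginv G b) by rewrite fsrc_mul // ftgt_inv.
by rewrite -(fmulA sV vv) fmulK // fmulV ftgt_mul.
Qed.

Lemma fmulKl a b : gtgt G a = gtgt G b -> gmul G a (gmul G (ginv G a) b) = b.
Proof.
by move=> ab; rewrite -fmulA ?fsrc_inv ?ftgt_inv // fmulV fmul1l.
Qed.

Lemma fmulVKl a b : gsrc G a = gtgt G b -> gmul G (ginv G a) (gmul G a b) = b.
Proof.
by move=> ab; rewrite -fmulA ?fsrc_inv ?ftgt_inv // fmulVl fmul1l.
Qed.

End FullGroupoid.

(** * The general linear 2-groupoid *)

Section MatrixLemmas.
Variables (R : comUnitRingType) (l k : nat).
Implicit Types (d : 'M[R]_(k, l)) (J : 'M[R]_(l, k)).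

Lemma invmx_mulmx_eq n m (X : 'M[R]_n) (Y Z : 'M[R]_(n, m)) :
  X \in unitmx -> Y = X *m Z -> invmx X *m Y = Z.
Proof. by move=> uX ->; rewrite mulKmx. Qed.

Lemma mul_1Jd_r d J : d *m (1%:M + J *m d) = (1%:M + d *m J) *m d.
Proof. by rewrite mulmxDr mulmxDl mulmx1 mul1mx mulmxA. Qed.

(** Sylvester: [1 - d (1 + J d)^-1 J] inverts [1 + d J].  Of the two
    invertibility conditions on a 2-arrow only [1 + J d] needs to be checked. *)
Lemma unitmx_1dJ d J : 1%:M + J *m d \in unitmx -> 1%:M + d *m J \in unitmx.
Proof.
move=> u; have /(congr1 (fun X => d *m X *m J)) := mulmxV u.
set X := invmx _; rewrite mulmx1 => dXJ.
suff /mulmx1_unit[] : (1%:M + d *m J) *m (1%:M - d *m X *m J) = 1%:M by [].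
by rewrite mulmxBr mulmx1 !mulmxA -mul_1Jd_r -[d *m _ *m X]mulmxA dXJ addrK.
Qed.

End MatrixLemmas.

Lemma unitmx_1Jd (R : comUnitRingType) (l k : nat) (d : 'M[R]_(k, l)) (J : 'M[R]_(l, k)) :
  (1%:M + d *m J \in unitmx) = (1%:M + J *m d \in unitmx).
Proof. by apply/idP/idP; apply: unitmx_1dJ. Qed.

Section GL2.
Variables (R : realType) (l k : nat).
Implicit Types (d : 'M[R]_(k, l)) (J : 'M[R]_(l, k)) (A : 'M[R]_l) (B : 'M[R]_k).

Lemma GL2_setP (h : preGL2 R l k) :
  GL2_set h <-> exists d A J B,
    [/\ h = gl2 d A J B, A \in unitmx, B \in unitmx & 1%:M + J *m d \in unitmx].
Proof.
split=> -[d [A [J [B]]]] [-> ].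
  move=> uM uJ _; exists d, A, J, B; split=> //;
    by move: uM; rewrite unitmxE det_ublock unitrM -!unitmxE => /andP[].
move=> uA uB uJ; exists d, A, J, B; split=> //; last by rewrite unitmx_1Jd.
by rewrite unitmxE det_ublock unitrM -!unitmxE uA.
Qed.

Lemma dpart_gl2 d A J B : dpart (gl2 d A J B) = d. Proof. by []. Qed.
Lemma Apart_gl2 d A J B : Apart (gl2 d A J B) = A.
Proof. exact: block_mxKul. Qed.
Lemma Bpart_gl2 d A J B : Bpart (gl2 d A J B) = B.
Proof. exact: block_mxKdr. Qed.
Lemma Jpart_gl2 d A J B : B \in unitmx -> Jpart (gl2 d A J B) = J.
Proof. by move=> uB; rewrite /Jpart Bpart_gl2 block_mxKur mulmxK. Qed.
Definition gl2E := (dpart_gl2, Apart_gl2, Bpart_gl2, Jpart_gl2).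

(** The corner [A J' B' + J B B'] of the block product is [(J + A J' B^-1) B B']. *)
Lemma gl2M d d' A A' J J' B B' : B \in unitmx ->
  gmul (GL_ops20 R l k) (gl2 d A J B) (gl2 d' A' J' B') =
  gl2 d (A *m A') (J + A *m J' *m invmx B) (B *m B').
Proof.
move=> uB; rewrite /gl2 /= mulmx_block !mulmx0 !mul0mx !addr0 !add0r.
by rewrite mulmxDl [_ *m invmx B *m _]mulmxA mulmxKV // addrC !mulmxA.
Qed.

Lemma src21_gl2 d A J B : B \in unitmx ->
  gsrc (GL_ops21 R l k) (gl2 d A J B) = (d, invmx (1%:M + J *m d) *m A, B).
Proof. by move=> uB; rewrite /= /GL_src21 !gl2E. Qed.

Lemma tgt21_gl2 d A J B : B \in unitmx ->
  gtgt (GL_ops21 R l k) (gl2 d A J B) = (d, A, (1%:M + d *m J) *m B).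
Proof. by move=> uB; rewrite /= /GL_tgt21 !gl2E. Qed.

(** Since [(1 + d J)^-1 d = d (1 + J d)^-1], the source over the objects can be
    read off the source 1-arrow as well as off the target one. *)
Lemma src20_gl2 d A J B : B \in unitmx -> 1%:M + J *m d \in unitmx ->
  gsrc (GL_ops20 R l k) (gl2 d A J B) =
  invmx B *m d *m (invmx (1%:M + J *m d) *m A).
Proof.
move=> uB uJ; have uJ' := unitmx_1dJ uJ.
rewrite /= /GL_src20 !gl2E // -mulmxA; apply: invmx_mulmx_eq.
  by rewrite unitmx_mul uJ'.
by rewrite -!mulmxA mulKVmx // [RHS]mulmxA -mul_1Jd_r -mulmxA mulKVmx.
Qed.

Lemma GL2_gl2 d A J B : A \in unitmx -> B \in unitmx ->
  1%:M + J *m d \in unitmx -> @GL2_set R l k (gl2 d A J B).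
Proof. by move=> uA uB uJ; apply/GL2_setP; exists d, A, J, B. Qed.

Lemma gpd_GL10 : is_groupoid (H10 (GL_two_gpd R l k)).
Proof.
split => //=.
- by move=> [[d A] B] [[d' A'] B'] [/= uA uB] [/= uA' uB'] _;
  rewrite /GL1_set /= !unitmx_mul uA uB.
- by move=> d _; split; apply: unitmx1.
- by move=> [[d A] B] [/= uA uB]; rewrite /GL1_set /= !unitmx_inv.
- move=> [[d A] B] [[d' A'] B'] [/= uA uB] [/= uA' uB'] <-.
  rewrite -!mulmxA; apply: invmx_mulmx_eq; first by rewrite unitmx_mul uB.
  by rewrite -!mulmxA !mulKVmx.
- by move=> [[d A] B] [[d' A'] B'] [[d'' A''] B''] /= *; rewrite !mulmxA.
- by move=> d _; rewrite invmx1 mul1mx mulmx1.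
- by move=> [[d A] B] /= _; rewrite !mul1mx.
- by move=> [[d A] B] /= _; rewrite !mulmx1.
- by move=> [[d A] B] [/= uA uB]; rewrite invmxK -!mulmxA mulKVmx // mulmxV // mulmx1.
- by move=> [[d A] B].
- by move=> [[d A] B] [/= uA uB]; rewrite /= !mulmxV.
- by move=> [[d A] B] [/= uA uB]; rewrite /= !mulVmx.
Qed.

(** Why 2-arrows are closed under the product over the objects: the new
    [1 + J'' d] is a product of invertible matrices.  The identity also gives the
    source 1-arrow of a product. *)
Lemma GL20_mul_1Jd d d' A J J' B : A \in unitmx -> B \in unitmx ->
  1%:M + J *m d \in unitmx ->
  d' = gsrc (GL_ops20 R l k) (gl2 d A J B) ->
  1%:M + (J + A *m J' *m invmx B) *m d =
  A *m (1%:M + J' *m d') *m invmx A *m (1%:M + J *m d).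
Proof.
move=> uA uB uJ; rewrite src20_gl2 // => ->.
rewrite [A *m (1%:M + _)]mulmxDr mulmx1 !mulmxDl mulmxV // mul1mx addrA.
by rewrite -!mulmxA mulKVmx // mulVmx // mulmx1.
Qed.

Lemma GL20_mul_in h h' : GL2_set h -> GL2_set h' ->
  gsrc (GL_ops20 R l k) h = gtgt (GL_ops20 R l k) h' ->
  GL2_set (gmul (GL_ops20 R l k) h h').
Proof.
move=> /GL2_setP[d [A [J [B [-> uA uB uJ]]]]].
move=> /GL2_setP[d' [A' [J' [B' [-> uA' uB' uJ']]]]] sE.
rewrite gl2M //; apply: GL2_gl2; rewrite ?unitmx_mul ?uA ?uB //.
by rewrite (GL20_mul_1Jd J' uA uB uJ (esym sE)) !unitmx_mul uA uJ' unitmx_inv uA.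
Qed.

Lemma GL21_src_in h : GL2_set h -> @GL1_set R l k (gsrc (GL_ops21 R l k) h).
Proof.
move=> /GL2_setP[d [A [J [B [-> uA uB uJ]]]]]; rewrite src21_gl2 //.
by split=> //=; rewrite unitmx_mul unitmx_inv uJ.
Qed.

Lemma GL21_tgt_in h : GL2_set h -> @GL1_set R l k (gtgt (GL_ops21 R l k) h).
Proof.
move=> /GL2_setP[d [A [J [B [-> uA uB uJ]]]]]; rewrite tgt21_gl2 //.
by split=> //=; rewrite unitmx_mul unitmx_1Jd uJ.
Qed.

Lemma GL_src10_tgt21 h :
  gsrc (GL_ops10 R l k) (gtgt (GL_ops21 R l k) h) = gsrc (GL_ops20 R l k) h.
Proof. by []. Qed.

Lemma GL_src10_src21 h : GL2_set h ->
  gsrc (GL_ops10 R l k) (gsrc (GL_ops21 R l k) h) = gsrc (GL_ops20 R l k) h.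
Proof.
by move=> /GL2_setP[d [A [J [B [-> uA uB uJ]]]]]; rewrite src21_gl2 // src20_gl2.
Qed.

Lemma GL21_tgt_mul20 h h' : GL2_set h -> GL2_set h' ->
  gsrc (GL_ops20 R l k) h = gtgt (GL_ops20 R l k) h' ->
  gtgt (GL_ops21 R l k) (gmul (GL_ops20 R l k) h h') =
  gmul (GL_ops10 R l k) (gtgt (GL_ops21 R l k) h) (gtgt (GL_ops21 R l k) h').
Proof.
move=> /GL2_setP[d [A [J [B [-> uA uB uJ]]]]].
move=> /GL2_setP[d' [A' [J' [B' [-> uA' uB' uJ']]]]] sE.
have uBB' : B *m B' \in unitmx by rewrite unitmx_mul uB.
rewrite gl2M // !tgt21_gl2 //=; congr (_, _, _).
(* the equation defining [d'] in terms of the target 1-arrow *)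
have dE : (1%:M + d *m J) *m B *m d' = d *m A.
  rewrite /= in sE; rewrite -sE /GL_src20 !gl2E // -[X in _ *m X]mulmxA mulKVmx //.
  by rewrite unitmx_mul unitmx_1Jd uJ.
rewrite mulmxDr addrA [LHS]mulmxDl [X in _ = _ *m X]mulmxDl mul1mx.
rewrite [RHS]mulmxDr !mulmxA dE -!mulmxA; congr (_ + _).
by rewrite (mulKmx uB).
Qed.

Lemma GL21_src_mul20 h h' : GL2_set h -> GL2_set h' ->
  gsrc (GL_ops20 R l k) h = gtgt (GL_ops20 R l k) h' ->
  gsrc (GL_ops21 R l k) (gmul (GL_ops20 R l k) h h') =
  gmul (GL_ops10 R l k) (gsrc (GL_ops21 R l k) h) (gsrc (GL_ops21 R l k) h').
Proof.
move=> /GL2_setP[d [A [J [B [-> uA uB uJ]]]]].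
move=> /GL2_setP[d' [A' [J' [B' [-> uA' uB' uJ']]]]] sE.
have uBB' : B *m B' \in unitmx by rewrite unitmx_mul uB.
rewrite gl2M // !src21_gl2 //=; congr (_, _, _).
rewrite (GL20_mul_1Jd J' uA uB uJ (esym sE)) {sE}.
apply: invmx_mulmx_eq; first by rewrite !unitmx_mul unitmx_inv uA uJ uJ'.
by rewrite -!mulmxA mulKVmx // mulKmx // mulKVmx.
Qed.

(** The block inverse has upper right corner [- A^-1 J = (- A^-1 J B) B^-1]. *)
Lemma GL20_inv d A J B : A \in unitmx -> B \in unitmx ->
  1%:M + J *m d \in unitmx ->
  ginv (GL_ops20 R l k) (gl2 d A J B) =
  gl2 (gsrc (GL_ops20 R l k) (gl2 d A J B)) (invmx A) (- (invmx A *m J *m B)) (invmx B).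
Proof.
move=> uA uB uJ; congr (_, _).
rewrite -[LHS]mulmx1; apply: invmx_mulmx_eq.
  by rewrite unitmxE det_ublock unitrM -!unitmxE uA.
rewrite mulmx_block !mulmx0 !mul0mx !addr0 !add0r !mulmxV //.
rewrite !mulNmx mulmxN -!mulmxA !mulKVmx // addNr.
by rewrite -scalar_mx_block.
Qed.

Lemma GL20_inv_1Jd d A J B : A \in unitmx -> B \in unitmx ->
  1%:M + J *m d \in unitmx ->
  1%:M - (invmx A *m J *m B) *m gsrc (GL_ops20 R l k) (gl2 d A J B) =
  invmx A *m (invmx (1%:M + J *m d) *m A).
Proof.
move=> uA uB uJ; rewrite src20_gl2 // -!mulmxA mulKVmx //.
rewrite -[X in X - _](mulVmx uA) -mulmxBr; congr (_ *m _).
rewrite -[X in X - _](mulKVmx uJ A) mulmxDl mul1mx.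
by rewrite -!mulmxA addrK.
Qed.

(** The source over the objects is that of the target 1-arrow, by definition;
    the action groupoid over 1-arrows therefore gives the source of a
    product. *)
Lemma gpd_GL20 : is_groupoid (H20 (GL_two_gpd R l k)).
Proof.
have invP h : GL2_set h -> GL2_set (ginv (GL_ops20 R l k) h) /\
    gsrc (GL_ops20 R l k) (ginv (GL_ops20 R l k) h) = gtgt (GL_ops20 R l k) h.
  move=> /GL2_setP[d [A [J [B [-> uA uB uJ]]]]]; rewrite GL20_inv //.
  have uAi : invmx A \in unitmx by rewrite unitmx_inv.
  have uBi : invmx B \in unitmx by rewrite unitmx_inv.
  have jE := GL20_inv_1Jd uA uB uJ.
  have u1 : 1%:M - (invmx A *m J *m B) *m gsrc (GL_ops20 R l k) (gl2 d A J B)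
      \in unitmx by rewrite jE !unitmx_mul !unitmx_inv uA uJ.
  split; first by apply: GL2_gl2; rewrite ?mulNmx.
  rewrite src20_gl2 ?mulNmx // jE [gtgt _ _]/= invmxK src20_gl2 //.
  rewrite -!mulmxA mulKVmx //.
  set X := invmx (_ *m (_ *m A)).
  have -> : X = invmx A *m (1%:M + J *m d) *m A.
    rewrite /X -[LHS]mulmx1; apply: invmx_mulmx_eq.
      by rewrite !unitmx_mul !unitmx_inv uA uJ.
    by rewrite -!mulmxA mulKVmx // mulKmx // mulVmx.
  by rewrite -!mulmxA mulKVmx // mulKmx // mulmxV // mulmx1.
split => //=.
- exact: GL20_mul_in.
- move=> d _; exists d, 1%:M, 0, 1%:M; split; rewrite ?mul0mx ?mulmx0 ?addr0 ?unitmx1 //.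
  by rewrite /gl2 mul0mx -scalar_mx_block.
- by move=> h /invP[].
- move=> h h' Hh Hh' sE.
  change (gsrc (GL_ops10 R l k) (gtgt (GL_ops21 R l k) (gmul (GL_ops20 R l k) h h')) =
    gsrc (GL_ops10 R l k) (gtgt (GL_ops21 R l k) h')).
  rewrite GL21_tgt_mul20 //; apply: (gsrc_mul gpd_GL10); try exact: GL21_tgt_in.
  exact: sE.
- by move=> [d M] [d' M'] [d'' M''] /= *; rewrite mulmxA.
- move=> d _; rewrite /GL_src20 /=.
  have -> : (d, 1%:M) = gl2 d 1%:M 0 1%:M :> preGL2 R l k.
    by rewrite /gl2 mul0mx -scalar_mx_block.
  by rewrite !gl2E ?unitmx1 // mulmx0 addr0 !mulmx1 invmx1 mul1mx.
- by move=> [d M] _ /=; rewrite mul1mx.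
- by move=> [d M] _ /=; rewrite mulmx1.
- by move=> h /invP[].
- move=> h /GL2_setP[d [A [J [B [-> uA uB uJ]]]]] /=.
  by rewrite mulmxV // unitmxE det_ublock unitrM -!unitmxE uA uB.
- move=> h /GL2_setP[d [A [J [B [-> uA uB uJ]]]]] /=.
  by rewrite mulVmx // unitmxE det_ublock unitrM -!unitmxE uA uB.
Qed.

Lemma gl2_mul21 d d' A A' J J' B B' : B \in unitmx -> B' \in unitmx ->
  gmul (GL_ops21 R l k) (gl2 d A J B) (gl2 d' A' J' B') =
  gl2 d A (J *m d *m J' + J + J') B'.
Proof. by move=> uB uB'; rewrite /= !gl2E. Qed.

(** The product over the 1-arrows is designed for [J |-> 1 + J d] and
    [J |-> 1 + d J] to be multiplicative; this gives closure and the source and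
    target of a product. *)
Lemma GL21_mul_1Jd d J J' :
  1%:M + (J *m d *m J' + J + J') *m d = (1%:M + J *m d) *m (1%:M + J' *m d).
Proof.
rewrite mulmxDr mulmx1 !mulmxDl mul1mx -!mulmxA -[RHS]addrA; congr (_ + _).
by rewrite -addrA addrC -addrA.
Qed.

Lemma GL21_composable h h' : GL2_set h -> GL2_set h' ->
  gsrc (GL_ops21 R l k) h = gtgt (GL_ops21 R l k) h' ->
  exists d A J J' B,
    [/\ h = gl2 d A J ((1%:M + d *m J') *m B),
        h' = gl2 d (invmx (1%:M + J *m d) *m A) J' B,
        A \in unitmx /\ B \in unitmx, 1%:M + J *m d \in unitmx
      & 1%:M + J' *m d \in unitmx].
Proof.
move=> /GL2_setP[d [A [J [B [-> uA uB uJ]]]]].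
move=> /GL2_setP[d' [A' [J' [B' [-> uA' uB' uJ']]]]].
rewrite src21_gl2 // tgt21_gl2 // => -[dE AE BE]; subst d' A' B.
by exists d, A, J, J', B'; split.
Qed.

Lemma GL21_mul_1dJ d J J' :
  1%:M + d *m (J *m d *m J' + J + J') = (1%:M + d *m J) *m (1%:M + d *m J').
Proof.
rewrite mulmxDl mul1mx !mulmxDr mulmx1 -!mulmxA -[RHS]addrA; congr (_ + _).
by rewrite addrC; congr (_ + _); rewrite addrC.
Qed.

Lemma GL21_inv d A J B : B \in unitmx ->
  ginv (GL_ops21 R l k) (gl2 d A J B) =
  gl2 d (invmx (1%:M + J *m d) *m A) (- (invmx (1%:M + J *m d) *m J))
    ((1%:M + d *m J) *m B).
Proof. by move=> uB; rewrite /= /GL_src21 !gl2E. Qed.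

Lemma GL21_inv_1Jd d J : 1%:M + J *m d \in unitmx ->
  1%:M - invmx (1%:M + J *m d) *m J *m d = invmx (1%:M + J *m d).
Proof.
move=> uJ; rewrite -{1}(mulVmx uJ) mulmxDr mulmx1.
by rewrite -!mulmxA addrK.
Qed.

Lemma GL21_inv_1dJ d J : 1%:M + J *m d \in unitmx ->
  (1%:M - d *m (invmx (1%:M + J *m d) *m J)) *m (1%:M + d *m J) = 1%:M.
Proof.
move=> uJ; rewrite mulmxBl mul1mx -[in X in _ - X]mulmxA -[in X in _ - X]mulmxA.
have -> : J *m (1%:M + d *m J) = (1%:M + J *m d) *m J by rewrite mul_1Jd_r.
by rewrite mulKmx // addrK.
Qed.

Lemma gpd_GL21 : is_groupoid (H21 (GL_two_gpd R l k)).
Proof.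
have invP h : GL2_set h -> [/\ GL2_set (ginv (GL_ops21 R l k) h),
    gsrc (GL_ops21 R l k) (ginv (GL_ops21 R l k) h) = gtgt (GL_ops21 R l k) h
  & gtgt (GL_ops21 R l k) (ginv (GL_ops21 R l k) h) = gsrc (GL_ops21 R l k) h].
  move=> /GL2_setP[d [A [J [B [-> uA uB uJ]]]]]; rewrite GL21_inv //.
  have uB' : (1%:M + d *m J) *m B \in unitmx by rewrite unitmx_mul unitmx_1Jd uJ.
  split.
  - by apply: GL2_gl2; rewrite // ?mulNmx ?GL21_inv_1Jd // ?unitmx_mul unitmx_inv uJ.
  - by rewrite src21_gl2 // tgt21_gl2 // mulNmx GL21_inv_1Jd // invmxK mulKVmx.
  - by rewrite src21_gl2 // tgt21_gl2 // mulmxN mulmxA GL21_inv_1dJ // mul1mx.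
have mulP h h' : GL2_set h -> GL2_set h' ->
    gsrc (GL_ops21 R l k) h = gtgt (GL_ops21 R l k) h' ->
    [/\ GL2_set (gmul (GL_ops21 R l k) h h'),
    gsrc (GL_ops21 R l k) (gmul (GL_ops21 R l k) h h') = gsrc (GL_ops21 R l k) h'
  & gtgt (GL_ops21 R l k) (gmul (GL_ops21 R l k) h h') = gtgt (GL_ops21 R l k) h].
  move=> Hh Hh' /(GL21_composable Hh Hh')[d [A [J [J' [B [-> -> [uA uB] uJ uJ']]]]]].
  have uB' : (1%:M + d *m J') *m B \in unitmx by rewrite unitmx_mul unitmx_1Jd uJ'.
  rewrite gl2_mul21 //; split.
  - by apply: GL2_gl2; rewrite // GL21_mul_1Jd unitmx_mul uJ.
  - rewrite !src21_gl2 // GL21_mul_1Jd; congr (_, _, _).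
    apply: invmx_mulmx_eq; first by rewrite unitmx_mul uJ.
    by rewrite -!mulmxA mulKVmx // mulKVmx.
  - by rewrite !tgt21_gl2 // GL21_mul_1dJ mulmxA.
split => //=.
- exact: GL21_src_in.
- exact: GL21_tgt_in.
- by move=> h h' Hh Hh' /(mulP _ _ Hh Hh')[].
- move=> [[d A] B] [/= uA uB].
  by apply: GL2_gl2; rewrite // mul0mx addr0 unitmx1.
- by move=> h /invP[].
- by move=> h h' Hh Hh' /(mulP _ _ Hh Hh')[].
- by move=> h h' Hh Hh' /(mulP _ _ Hh Hh')[].
- move=> h h' h'' /GL2_setP[d [A [J [B [-> uA uB uJ]]]]].
  move=> /GL2_setP[d' [A' [J' [B' [-> uA' uB' uJ']]]]].
  move=> /GL2_setP[d'' [A'' [J'' [B'' [-> uA'' uB'' uJ'']]]]].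
  rewrite /GL_src21 /GL_tgt21 !gl2E // => -[dE _ _] [dE' _ _].
  subst d'' d'; congr (gl2 _ _ _ _).
  rewrite !mulmxDr !mulmxDl -!mulmxA !addrA.
  by rewrite [LHS](ACl (1*4*2*5*3*6*7)).
- move=> [[d A] B] [/= uA uB]; rewrite /GL_src21 !gl2E //.
  by rewrite mul0mx addr0 invmx1 mul1mx.
- move=> [[d A] B] [/= uA uB]; rewrite /GL_tgt21 !gl2E //.
  by rewrite mulmx0 addr0 mul1mx.
- move=> h /GL2_setP[d [A [J [B [-> uA uB uJ]]]]].
  have uB' : (1%:M + d *m J) *m B \in unitmx by rewrite unitmx_mul unitmx_1Jd uJ.
  by rewrite !gl2E // !mul0mx !add0r.
- move=> h /GL2_setP[d [A [J [B [-> uA uB uJ]]]]].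
  by rewrite !gl2E // !mulmx0 add0r addr0.
- by move=> h /invP[].
- by move=> h /invP[].
- move=> h /GL2_setP[d [A [J [B [-> uA uB uJ]]]]].
  have uB' : (1%:M + d *m J) *m B \in unitmx by rewrite unitmx_mul unitmx_1Jd uJ.
  rewrite /GL_src21 /= !gl2E //; congr (gl2 _ _ _ _).
  (* [J = Y + J d Y] for [- Y] the J-part of the inverse *)
  have := mulKVmx uJ J; rewrite mulmxDl mul1mx => JE.
  by rewrite mulmxN addrAC -opprD addrC [X in _ - X]addrC JE subrr.
- move=> h /GL2_setP[d [A [J [B [-> uA uB uJ]]]]].
  have uB' : (1%:M + d *m J) *m B \in unitmx by rewrite unitmx_mul unitmx_1Jd uJ.
  rewrite /GL_src21 /= !gl2E //; congr (gl2 _ _ _ _).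
  have := mulKmx uJ J; rewrite mulmxDl mul1mx mulmxDr !mulmxA => JE.
  by rewrite !mulNmx -opprD addrC [X in _ - X]addrC JE subrr.
Qed.

(** In coordinates only the J-parts are at stake.  Writing [A = A' + J d A'],
    [B'^-1 = B^-1 d J' + B^-1] and [e = B^-1 d A'] for the middle point [e], both
    sides expand to the same eight terms. *)
Lemma GL_interchange h1 h1' h2 h2' : GL2_set h1 -> GL2_set h1' ->
  GL2_set h2 -> GL2_set h2' ->
  gsrc (GL_ops20 R l k) h1 = gtgt (GL_ops20 R l k) h2 ->
  gsrc (GL_ops20 R l k) h1' = gtgt (GL_ops20 R l k) h2' ->
  gsrc (GL_ops21 R l k) h1 = gtgt (GL_ops21 R l k) h1' ->
  gsrc (GL_ops21 R l k) h2 = gtgt (GL_ops21 R l k) h2' ->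
  gmul (GL_ops20 R l k) (gmul (GL_ops21 R l k) h1 h1') (gmul (GL_ops21 R l k) h2 h2') =
  gmul (GL_ops21 R l k) (gmul (GL_ops20 R l k) h1 h2) (gmul (GL_ops20 R l k) h1' h2').
Proof.
move=> H1 H1' H2 H2' s12 s12' /(GL21_composable H1 H1').
move=> [d [A [J [J' [B' [E1 E1' [uA uB'] uJ uJ']]]]]]; subst h1 h1'.
move=> /(GL21_composable H2 H2').
move=> [e [A2 [J2 [J2' [B2' [E2 E2' [uA2 uB2'] uJ2 uJ2']]]]]]; subst h2 h2'.
have uB : (1%:M + d *m J') *m B' \in unitmx by rewrite unitmx_mul unitmx_1Jd uJ'.
have uB2 : (1%:M + e *m J2') *m B2' \in unitmx by rewrite unitmx_mul unitmx_1Jd uJ2'.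
move: s12; rewrite src20_gl2 // [gtgt _ _]/= => eE.
have uBB2 : (1%:M + d *m J') *m B' *m ((1%:M + e *m J2') *m B2') \in unitmx.
  by rewrite unitmx_mul uB.
have uBB2' : B' *m B2' \in unitmx by rewrite unitmx_mul uB'.
rewrite (gl2_mul21 d d A _ J J' uB uB') // (gl2_mul21 e e A2 _ J2 J2' uB2 uB2') //.
rewrite (gl2M d e A A2 _ _ _ uB') (gl2M d e A A2 J J2 _ uB) (gl2M d e _ _ J' J2' _ uB').
rewrite (gl2_mul21 d d _ _ _ _ uBB2 uBB2').
congr (gl2 _ _ _ _).
set B := (1%:M + d *m J') *m B' in uB eE *; set A' := invmx (1%:M + J *m d) *m A in eE *.
have AE : A = A' + J *m d *m A' by rewrite -[LHS](mulKVmx uJ) mulmxDl mul1mx.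
have BE : invmx B *m d *m J' + invmx B = invmx B'.
  have : invmx B *m (1%:M + d *m J') = invmx B'.
    by rewrite -[LHS](mulmxK uB') -[_ *m B']mulmxA mulVmx // mul1mx.
  by rewrite mulmxDr mulmx1 mulmxA addrC.
have AJ2E : A *m (J2 *m invmx B') =
    A *m (J2 *m (invmx B *m (d *m J'))) + A *m (J2 *m invmx B).
  by rewrite -BE !mulmxDr !mulmxA.
have AJ2'E : A *m (J2' *m invmx B') =
    A' *m (J2' *m invmx B') + J *m (d *m (A' *m (J2' *m invmx B'))).
  by rewrite {1}AE mulmxDl !mulmxA.
rewrite -{}eE -/A' -/B; clearbody A' B.
rewrite !mulmxDl !mulmxDr !mulmxDl -!mulmxA AJ2E AJ2'E !addrA.
by rewrite [LHS](ACl (1*8*5*4*2*6*3*7)).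
Qed.

Lemma GL21_unit_mul20 a b : @GL1_set R l k a ->
  gmul (GL_ops20 R l k) (gunit (GL_ops21 R l k) a) (gunit (GL_ops21 R l k) b) =
  gunit (GL_ops21 R l k) (gmul (GL_ops10 R l k) a b).
Proof.
move: a b => [[d A] B] [[d' A'] B'] [/= uA uB].
by have := gl2M d d' A A' 0 0 B' uB; rewrite mulmx0 mul0mx addr0.
Qed.

Lemma two_groupoid_GL : is_two_groupoid (GL_two_gpd R l k).
Proof.
have inv_in := ginv_in gpd_GL21; have mul_in := gmul_in gpd_GL20.
split; [exact: gpd_GL10|exact: gpd_GL20|exact: gpd_GL21|..].
- exact: GL_src10_src21.
- by move=> h _; apply: GL_src10_tgt21.
- by [].
- by [].
- by move=> d _; rewrite /= /gl2 mul0mx -scalar_mx_block.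
split.
- by move=> [a b] [/= Ha Hb sE]; apply: (gmul_in gpd_GL10).
- by move=> [h h'] [/= Hh Hh' sE]; apply: mul_in.
- by move=> [h h'] [/= Hh Hh' sE]; apply: GL21_src_mul20.
- by move=> [h h'] [/= Hh Hh' sE]; apply: GL21_tgt_mul20.
- move=> [h1 h2] [h1' h2'] [/= H1 H2 sE] [/= H1' H2' sE'] tE.
  exact: (GL_interchange H1 H1' H2 H2' sE sE'
    (congr1 fst tE) (congr1 snd tE)).
- by move=> [a b] [/= Ha Hb sE]; rewrite [LHS]GL21_unit_mul20.
(* inverses: interchange makes the product of the inverses an inverse *)
- move=> [h h'] [/= Hh Hh' sE].
  set i := ginv (GL_ops21 R l k) h; set i' := ginv (GL_ops21 R l k) h'.
  have Hi : GL2_set i by exact: inv_in.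
  have Hi' : GL2_set i' by exact: inv_in.
  have sEi : gsrc (GL_ops20 R l k) i = gtgt (GL_ops20 R l k) i'.
    transitivity (gsrc (GL_ops20 R l k) h); last exact: sE.
    have tE : gtgt (GL_ops21 R l k) i = gsrc (GL_ops21 R l k) h := gtgt_inv gpd_GL21 Hh.
    change (gsrc (GL_ops10 R l k) (gtgt (GL_ops21 R l k) i) = gsrc (GL_ops20 R l k) h).
    by rewrite tE; apply: GL_src10_src21.
  change (gmul (GL_ops20 R l k) i i' =
    ginv (H21 (GL_two_gpd R l k)) (gmul (GL_ops20 R l k) h h')).
  apply: (ginv_uniq gpd_GL21).
  + exact: mul_in.
  + exact: mul_in.
  + rewrite [LHS]GL21_src_mul20 // [RHS]GL21_tgt_mul20 //.
    by rewrite !(gtgt_inv gpd_GL21).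
  + rewrite -[LHS]/(gmul (GL_ops21 R l k) _ _) -GL_interchange //; last 2 first.
    * by rewrite (gtgt_inv gpd_GL21).
    * by rewrite (gtgt_inv gpd_GL21).
    rewrite !(gmulV gpd_GL21) // GL21_unit_mul20; last exact: GL21_tgt_in.
    by congr gunit; rewrite [RHS]GL21_tgt_mul20.
Qed.

End GL2.

(** * Linear maps and frames *)

(** Frames are bare functions, for which linearity is a hypothesis. *)
Section RawLinear.
Variables (R : nzRingType) (U V : lmodType R) (f : U -> V).
Hypothesis lf : linear f.

Lemma lin0 : f 0 = 0.
Proof. by have := lf 1 0 0; rewrite !scale1r addr0 -{1}[f 0]addr0 => /addrI. Qed.
Lemma linD u v : f (u + v) = f u + f v.
Proof. by have := lf 1 u v; rewrite !scale1r. Qed.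
Lemma linZ a u : f (a *: u) = a *: f u.
Proof. by have := lf a u 0; rewrite lin0 !addr0. Qed.
Lemma linN u : f (- u) = - f u.
Proof. by rewrite -scaleN1r linZ scaleN1r. Qed.

Lemma lin_inj : (forall u, f u = 0 -> u = 0) -> injective f.
Proof. by move=> K u v uv; apply/eqP; rewrite -subr_eq0; apply/eqP/K; rewrite linD linN uv subrr. Qed.

End RawLinear.

Lemma mulmx_ext (R : nzRingType) m n (M N : 'M[R]_(m, n)) :
  (forall x : 'cV[R]_n, M *m x = N *m x) -> M = N.
Proof.
move=> MN; apply/matrixP => i j; have := MN (delta_mx j 0).
by rewrite -!colE => /colP/(_ i); rewrite !mxE.
Qed.

Section Precomp.
Variables (R : realType) (n : nat) (V : vectType R).
Implicit Types (phi : 'cV[R]_n -> V) (M : 'M[R]_n).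

Lemma precomp1 phi : precomp phi 1%:M = phi.
Proof. by apply/funext => x; rewrite /precomp mul1mx. Qed.

Lemma precompM phi M N : precomp (precomp phi M) N = precomp phi (M *m N).
Proof. by apply/funext => x; rewrite /precomp mulmxA. Qed.

Lemma is_frame_precomp (S : set V) phi M : M \in unitmx ->
  is_frame S phi -> is_frame S (precomp phi M).
Proof.
move=> uM [lp ip rp]; split.
- by move=> a u v; rewrite /precomp linearP lp.
- by move=> u v /ip /(congr1 (mulmx (invmx M))); rewrite !mulKmx.
- rewrite -rp; apply/seteqP; split=> [_ [x _ <-]|_ [x _ <-]].
    by exists (M *m x).
  by exists (invmx M *m x); rewrite // /precomp mulKVmx.
Qed.

(** An injective frame detects the matrix it is composed with: this makes both
    actions free. *)
Lemma precomp_free phi M : injective phi -> precomp phi M =1 phi -> M = 1%:M.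
Proof. by move=> ip Mphi; apply: mulmx_ext => x; rewrite mul1mx; apply: ip; apply: Mphi. Qed.

End Precomp.

(** * Points of the total spaces *)

Section Total.
Variables (R : realType) (l k : nat) (E : vb_groupoid R l k).
Local Notation G := (G0 E).
Implicit Types (phi psi chi : preframe1 E) (p q : preframe0 E).

Definition TG : gpd_ops {x : Mtype E & EM E x} {g : Gtype E & EG E g} :=
  total_ops (fun g => vsrc E g) (fun g => vtgt E g) (@vmul R l k E)
       (fun x => vunit E x) (fun g => vinv E g).
Definition totG : is_groupoid (full_gpd TG) := lie_gpd (E_lie E).
Local Notation baseG := (baseG E).

Definition ptM x (v : EM E x) : {x : Mtype E & EM E x} := Tagged (fun x => EM E x) v.
Definition ptG g (e : EG E g) : {g : Gtype E & EG E g} := Tagged (fun g => EG E g) e.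

Lemma ptM_inj x : injective (@ptM x).
Proof.
move=> v w vw; have := projT2_eq vw.
by rewrite (Prop_irrelevance (projT1_eq vw) erefl).
Qed.

Lemma ptG_inj g : injective (@ptG g).
Proof.
move=> v w vw; have := projT2_eq vw.
by rewrite (Prop_irrelevance (projT1_eq vw) erefl).
Qed.

Lemma ptM_cast x y (p : x = y) (v : EM E x) : ptM (castEM p v) = ptM v.
Proof. by case: y / p. Qed.
Lemma ptG_cast x y (p : x = y) (v : EG E x) : ptG (castEG p v) = ptG v.
Proof. by case: y / p. Qed.

Lemma ptG_D g g' (a b : EG E g) (a' b' : EG E g') :
  ptG a = ptG a' -> ptG b = ptG b' -> ptG (a + b) = ptG (a' + b').
Proof.
move=> aa'; have gg' : g = g' := projT1_eq aa'.
by case: g' / gg' a' b' aa' => a' b' /ptG_inj -> /ptG_inj ->.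
Qed.

Lemma ptG_Z g g' (c : R) (a : EG E g) (a' : EG E g') :
  ptG a = ptG a' -> ptG (c *: a) = ptG (c *: a').
Proof.
move=> aa'; have gg' : g = g' := projT1_eq aa'.
by case: g' / gg' a' aa' => a' /ptG_inj ->.
Qed.

(* the zero sections *)
Definition zG g := ptG (0 : EG E g).
Definition zM x := ptM (0 : EM E x).

Lemma ptG_eq0 g g' (e : EG E g) : ptG e = zG g' -> e = 0.
Proof.
move=> e0; have gg' : g = g' := projT1_eq e0.
by case: g' / gg' e0 => /ptG_inj.
Qed.

Lemma src_zG g : gsrc TG (zG g) = zM (gsrc G g).
Proof. by congr (ptM _); rewrite /= linear0. Qed.
Lemma tgt_zG g : gtgt TG (zG g) = zM (gtgt G g).
Proof. by congr (ptM _); rewrite /= linear0. Qed.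
Lemma inv_zG g : ginv TG (zG g) = zG (ginv G g).
Proof. by congr (ptG _); rewrite /= linear0. Qed.
Lemma unit_zM x : gunit TG (zM x) = zG (gunit G x).
Proof. by congr (ptG _); rewrite /= linear0. Qed.

Lemma src_ker g (e : EG E g) : vsrc E g e = 0 -> gsrc TG (ptG e) = zM (gsrc G g).
Proof. by move=> e0; congr (ptM _). Qed.
Lemma tgt_ker g (e : EG E g) : vtgt E g e = 0 -> gtgt TG (ptG e) = zM (gtgt G g).
Proof. by move=> e0; congr (ptM _). Qed.
Lemma ker_src g x (e : EG E g) : gsrc TG (ptG e) = zM x -> vsrc E g e = 0.
Proof.
move=> e0; have xE : gsrc G g = x := projT1_eq e0.
by case: x / xE e0 => /ptM_inj.
Qed.

Lemma ker_tgt g x (e : EG E g) : gtgt TG (ptG e) = zM x -> vtgt E g e = 0.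
Proof.
move=> e0; have xE : gtgt G g = x := projT1_eq e0.
by case: x / xE e0 => /ptM_inj.
Qed.

Lemma vmulD g h (a b : EG E g) (c d : EG E h) :
  gsrc TG (ptG a) = gtgt TG (ptG c) -> gsrc TG (ptG b) = gtgt TG (ptG d) ->
  vmul E (a + b) (c + d) = vmul E a c + vmul E b d.
Proof.
move=> ac bd; have gh : gsrc G g = gtgt G h := projT1_eq ac.
by have := vmul_linear 1 gh ac bd; rewrite !scale1r.
Qed.

Lemma mul_zG g h : gsrc G g = gtgt G h -> gmul TG (zG g) (zG h) = zG (gmul G g h).
Proof.
move=> gh; have zz : gsrc TG (zG g) = gtgt TG (zG h) by rewrite src_zG tgt_zG gh.
congr (ptG _); have /= := vmulD zz zz; rewrite !addr0 -{1}[vmul _ _ _]addr0.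
by move/addrI.
Qed.

(** Frames are compared pointwise in the total space: the values determine the
    base arrow, as the domain of a frame is never empty. *)
Lemma frame1_eq (phi psi : preframe1 E) :
  (forall w v, ptG (fr phi w v) = ptG (fr psi w v)) -> phi = psi.
Proof.
case: phi psi => [g phi] [h psi] phipsi.
have gh : g = h := projT1_eq (phipsi 0 0).
case: h / gh psi phipsi => psi phipsi; congr existT; apply/funext => x.
by rewrite -(vsubmxK x); apply: ptG_inj; apply: phipsi.
Qed.

Lemma frame0_eq (p q : preframe0 E) :
  (forall w, ptG ((tagged p).1 w) = ptG ((tagged q).1 w)) ->
  (forall v, ptM ((tagged p).2 v) = ptM ((tagged q).2 v)) -> p = q.
Proof.
case: p q => [x [c b]] [y [c' b']] /= cc' bb'.
have xy : x = y := projT1_eq (bb' 0).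
case: y / xy c' b' cc' bb' => c' b' cc' bb'; congr existT.
by congr pair; apply/funext => w; [apply: ptG_inj|apply: ptM_inj].
Qed.

Lemma fr_mulE (phi psi : preframe1 E) w v : fr (fr_mul phi psi) w v =
  vmul E (fr phi 0 v) (fr psi 0 v) + Rtr (tag psi) (fr phi w 0).
Proof. by rewrite /fr /= col_mxKu col_mxKd. Qed.
Lemma fr_unitE (p : preframe0 E) w v : fr (fr_unit p) w v =
  vunit E (tag p) ((tagged p).2 v) + (tagged p).1 w.
Proof. by rewrite /fr /= col_mxKu col_mxKd. Qed.
Lemma fr_invE (phi : preframe1 E) w v : fr (fr_inv phi) w v =
  vinv E (tag phi) (fr phi (- w) (v + mu phi *m w)).
Proof. by rewrite /fr /= col_mxKu col_mxKd. Qed.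

Lemma pt_tgt_c (phi : preframe1 E) w : ptG (tgt_c phi w) =
  gmul TG (ptG (fr phi w 0)) (zG (ginv G (tag phi))).
Proof. by rewrite ptG_cast. Qed.
Lemma pt_src_c (phi : preframe1 E) w : ptG (src_c phi w) =
  gmul TG (ginv TG (ptG (fr phi (- w) (mu phi *m w)))) (zG (tag phi)).
Proof. by rewrite ptG_cast. Qed.

(** A trivialization of E_M around x shows that the fibre has dimension k. *)
Lemma inj_cV_surj x (b : 'cV[R]_k -> EM E x) : linear b -> injective b ->
  forall e, exists v, b v = e.
Proof.
move=> lb ib e; have [U [psi [th [_ Ux triv _ _]]]] := (EM_bundle E).2 x.
have [lpsi psiK thK] := triv x Ux.
have lf : linear (psi x \o b) by move=> a u v; rewrite /= lb lpsi.
pose f : {linear 'cV[R]_k -> 'rV[R]_k} :=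
  HB.pack (psi x \o b) (GRing.isLinear.Build R _ _ _ (psi x \o b) lf).
have kf : (lker (linfun f) == 0)%VS.
  apply/lker0P => u v; rewrite !lfunE /=.
  by move=> /(can_inj psiK)/ib.
have : psi x e \in limg (linfun f).
  suff -> : limg (linfun f) = fullv by rewrite memvf.
  apply/eqP; rewrite eqEdim subvf limg_dim_eq ?(eqP kf) ?capv0 //.
  by rewrite !dimvf /dim /= mul1n muln1.
by move=> /memv_imgP[v _]; rewrite lfunE /= => /(can_inj psiK) ->; exists v.
Qed.

(** * The moment map *)

Lemma pt_anchor x (c : EG E (gunit G x)) : ptM (core_anchor c) = gtgt TG (ptG c).
Proof. exact: ptM_cast. Qed.

Lemma linear_anchor x : linear (@core_anchor R l k E x).
Proof.
have lc y (p : y = x) : linear (castEM (E := E) p) by case: x / p.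
by move=> a u v; rewrite /core_anchor linearP lc.
Qed.

Lemma mx_ofE (f : 'cV[R]_l -> 'cV[R]_k) : linear f -> forall w, mx_of f *m w = f w.
Proof.
move=> lf w; have fsum (I : Type) (r : seq I) (F : I -> 'cV[R]_l) :
    f (\sum_(i <- r) F i) = \sum_(i <- r) f (F i).
  by apply: big_morph; [exact: linD|exact: lin0].
rewrite {2}(matrix_sum_delta w) fsum; apply/colP => i.
rewrite summxE mxE; apply: eq_bigr => j _.
by rewrite big_ord1 linZ // !mxE mulrC.
Qed.

(** The characterization of the moment by [b o d = rho o c]; the formal inverse
    of [b] in the definition of the moment inverts [b] on its range, which is the
    whole fibre. *)
Lemma mu1P (p : preframe0 E) : frames0 p -> forall w,
  ptM ((tagged p).2 (mu1 p *m w)) = gtgt TG (ptG ((tagged p).1 w)).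
Proof.
move=> Fp w; rewrite -pt_anchor; congr ptM.
case: p Fp => x [c b] [/= [lc ic _] [lb ib bT]].
pose b' : {linear 'cV[R]_k -> EM E x} :=
  HB.pack b (GRing.isLinear.Build R _ _ _ b lb).
pose f := (linfun b')^-1%VF \o @core_anchor R l k E x \o c.
have lf : linear f.
  by move=> a u v; rewrite /f /= lc linear_anchor linearP.
rewrite -[mu1 _]/(mx_of f) mx_ofE //.
have : core_anchor (c w) \in limg (linfun b').
  have /inj_cV_surj-/(_ ib (core_anchor (c w)))[v <-] := lb.
  by rewrite -[b v](lfunE b') memv_img ?memvf.
by move/limg_lfunVK; rewrite lfunE.
Qed.

Lemma mu1_uniq (p : preframe0 E) D : frames0 p ->
  (forall w, ptM ((tagged p).2 (D *m w)) = gtgt TG (ptG ((tagged p).1 w))) ->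
  mu1 p = D.
Proof.
move=> Fp HD; have [_ [_ ib _]] := Fp.
apply/matrixP => i j; have : mu1 p *m delta_mx j 0 = D *m delta_mx j (0 : 'I_1).
  by apply: ib; apply: ptM_inj; rewrite mu1P // HD.
by rewrite -!colE => /colP/(_ i); rewrite !mxE.
Qed.

(** * s-bisection frames *)

(** Conditions which are easier to transport along the operations than those on
    complements of kernels: see [Fr_sbisP]. *)
Record sbis_frame (phi : preframe1 E) : Prop := SbisFrame {
  sbis_linear : linear (tagged phi);
  sbis_src0 : forall w, vsrc E (tag phi) (fr phi w 0) = 0;
  sbis_src_inj : injective (src_b phi);
  sbis_tgt : frames0 (fr_tgt phi) }.

Lemma linear_fr (phi : preframe1 E) : linear (tagged phi) ->
  forall a w w' v v', fr phi (a *: w + w') (a *: v + v') = a *: fr phi w v + fr phi w' v'.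
Proof. by move=> lp a w w' v v'; rewrite /fr -lp scale_col_mx add_col_mx. Qed.

Lemma linear_of_fr phi :
  (forall a w w' v v', fr phi (a *: w + w') (a *: v + v') = a *: fr phi w v + fr phi w' v') ->
  linear (tagged phi).
Proof.
move=> lp a x y; rewrite -(vsubmxK x) -(vsubmxK y) scale_col_mx add_col_mx.
exact: lp.
Qed.

Section LinearFrame.
Variable phi : preframe1 E.
Hypothesis lp : linear (tagged phi).

Lemma fr00 : fr phi 0 0 = 0.
Proof. by rewrite /fr col_mx0 lin0. Qed.
Lemma frD w w' v v' : fr phi (w + w') (v + v') = fr phi w v + fr phi w' v'.
Proof. by rewrite /fr -(linD lp) add_col_mx. Qed.
Lemma frN w v : fr phi (- w) (- v) = - fr phi w v.
Proof. by rewrite /fr -(linN lp) opp_col_mx. Qed.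
Lemma fr_split w v : fr phi w v = fr phi 0 v + fr phi w 0.
Proof. by rewrite -frD addr0 add0r. Qed.
Lemma linear_fr0 : linear (fr phi 0).
Proof. by move=> a u v; rewrite -linear_fr // scaler0 addr0. Qed.
Lemma linear_frw : linear (fun w => fr phi w 0).
Proof. by move=> a u v; rewrite -linear_fr // scaler0 addr0. Qed.
Lemma linear_src_b : linear (src_b phi).
Proof. by move=> a u v; rewrite /src_b linear_fr0 linearP. Qed.
Lemma linear_tgt_b : linear (tgt_b phi).
Proof. by move=> a u v; rewrite /tgt_b linear_fr0 linearP. Qed.

End LinearFrame.

(** Right translation by h, the product with [0_h], makes sense on the kernel of
    the source; [tgt_cK] recovers [phi(w, 0)] from the target core frame. *)
Lemma composable_zG g h (e : EG E g) : gsrc G g = gtgt G h -> vsrc E g e = 0 ->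
  gsrc TG (ptG e) = gtgt TG (zG h).
Proof. by move=> gh e0; rewrite src_ker // tgt_zG gh. Qed.

Lemma Rtr_linear g h (a : R) (e e' : EG E g) : gsrc G g = gtgt G h ->
  vsrc E g e = 0 -> vsrc E g e' = 0 ->
  Rtr h (a *: e + e') = a *: Rtr h e + Rtr h e'.
Proof.
move=> gh e0 e0'; have := vmul_linear a gh (composable_zG gh e0) (composable_zG gh e0').
by rewrite scaler0 addr0.
Qed.

Lemma linear_tgt_c (phi : preframe1 E) : linear (tagged phi) ->
  (forall w, vsrc E (tag phi) (fr phi w 0) = 0) -> linear (tgt_c phi).
Proof.
move=> lp s0 a u v; apply: ptG_inj; rewrite ptG_cast linear_frw //.
rewrite Rtr_linear ?(ftgt_inv baseG) //.
by apply: ptG_D; rewrite ?ptG_cast //; apply: ptG_Z; rewrite ptG_cast.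
Qed.

Lemma tgt_c_core (phi : preframe1 E) w :
  vsrc E (tag phi) (fr phi w 0) = 0 -> core (tgt_c phi w).
Proof.
move=> s0; apply: (@ker_src _ (gtgt G (tag phi))); rewrite pt_tgt_c.
have cz : gsrc TG (ptG (fr phi w 0)) = gtgt TG (zG (ginv G (tag phi))).
  by apply: composable_zG; rewrite ?(ftgt_inv baseG).
by rewrite (fsrc_mul totG cz) src_zG (fsrc_inv baseG).
Qed.

Lemma tgt_cK (phi : preframe1 E) w : vsrc E (tag phi) (fr phi w 0) = 0 ->
  gmul TG (ptG (tgt_c phi w)) (zG (tag phi)) = ptG (fr phi w 0).
Proof.
move=> s0; rewrite pt_tgt_c.
have -> : zG (tag phi) = ginv TG (zG (ginv G (tag phi))).
  by rewrite inv_zG (fginvK baseG).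
by rewrite (fmulK totG) //; apply: composable_zG; rewrite ?(ftgt_inv baseG).
Qed.

Lemma mul1lG (g : Gtype E) : gmul G (gunit G (gtgt G g)) g = g.
Proof. exact: (fmul1l baseG). Qed.

Lemma tgt_c_ker (phi : preframe1 E) w : vsrc E (tag phi) (fr phi w 0) = 0 ->
  tgt_c phi w = 0 -> fr phi w 0 = 0.
Proof.
move=> s0 t0; apply: (@ptG_eq0 _ (tag phi)); rewrite -tgt_cK // t0 mul_zG.
  by rewrite mul1lG.
by rewrite (fsrc_unit baseG).
Qed.

Lemma Hspace_compl (phi : preframe1 E) (V : vectType R)
    (p : {linear EG E (tag phi) -> V}) : linear (tagged phi) ->
  injective (p \o fr phi 0) -> (forall y, exists v, p (fr phi 0 v) = y) ->
  (Hspace phi + lker (linfun p) = fullv /\ Hspace phi :&: lker (linfun p) = 0)%VS.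
Proof.
move=> lp inj surj.
pose f : {linear 'cV[R]_k -> EG E (tag phi)} :=
  HB.pack (fr phi 0) (GRing.isLinear.Build R _ _ _ (fr phi 0) (linear_fr0 lp)).
have Hmem v : fr phi 0 v \in Hspace phi.
  by rewrite -[fr phi 0 v](lfunE f) memv_img ?memvf.
split; apply/vspaceP => e.
  rewrite memvf; apply/memv_addP; have [v ve] := surj (p e).
  exists (fr phi 0 v) => //; exists (e - fr phi 0 v); last by rewrite addrC subrK.
  by rewrite memv_ker lfunE /= linearB ve subrr.
rewrite memv_cap memv0; apply/andP/eqP => [[]|->]; last by rewrite !mem0v.
move=> /memv_imgP[v _]; rewrite (lfunE f) => -> /=.
rewrite memv_ker lfunE => /eqP /= pv.
by rewrite (inj v 0) /= ?fr00 // pv linear0.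
Qed.

(** From left to right, [phi(w, v)] in the kernel of the source forces
    [phi(0, v)] to be in the intersection of the kernel and its complement, hence
    [v = 0]: so [phi(w, 0)] fills the kernel, and right translation
    by the inverse of g carries it onto the core.  Conversely [phi(w, 0)] fills the kernel
    because right translation can be undone, and [phi(0, v)] spans a complement
    of both kernels because the two base maps are bijective. *)
Lemma Fr_sbisP (phi : preframe1 E) : Fr_sbis phi <-> sbis_frame phi.
Proof.
split.
- case=> -[lp ip rp] s0 [Hs0 Hs] [Ht0 Ht].
  pose f : {linear 'cV[R]_k -> EG E (tag phi)} :=
    HB.pack (fr phi 0) (GRing.isLinear.Build R _ _ _ (fr phi 0) (linear_fr0 lp)).
  have Hmem v : fr phi 0 v \in Hspace phi.
    by rewrite -[fr phi 0 v](lfunE f) memv_img ?memvf.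
  have fr_inj w v : fr phi w v = 0 -> w = 0 /\ v = 0.
    rewrite /fr -[RHS](lin0 lp) => /ip; rewrite -[RHS](col_mx0 R l k 1).
    by move=> /eq_col_mx[].
  have sinj v : src_b phi v = 0 -> v = 0.
    move=> sv; suff /fr_inj[] : fr phi 0 v = 0 by [].
    apply/eqP; rewrite -memv0 -Hs memv_cap Hmem memv_ker lfunE /=.
    by apply/eqP.
  have tinj v : tgt_b phi v = 0 -> v = 0.
    move=> tv; suff /fr_inj[] : fr phi 0 v = 0 by [].
    apply/eqP; rewrite -memv0 -Ht memv_cap Hmem memv_ker lfunE /=.
    by apply/eqP.
  split=> //; first exact: (lin_inj (linear_src_b lp) sinj).
  have itb := lin_inj (linear_tgt_b lp) tinj.
  split; last first.
    split=> //; [exact: linear_tgt_b|].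
    apply/seteqP; split=> // e _.
    by have [v <-] := inj_cV_surj (linear_tgt_b lp) itb e; exists v.
  split; first exact: linear_tgt_c.
    apply: (lin_inj (linear_tgt_c lp s0)) => w /(tgt_c_ker (s0 w)).
    by move=> /fr_inj[].
  apply/seteqP; split=> [_ [w _ <-]|e]; first exact: tgt_c_core.
  rewrite /core /= => e0.
  (* translate e to g and look for it in the range of [phi] *)
  pose e' := castEG (mul1lG (tag phi)) (Rtr (tag phi) e).
  have : range (tagged phi) e' by rewrite rp.
  case=> x _; rewrite -(vsubmxK x) -/(fr _ _ _) => e'E.
  have cz : gsrc TG (ptG e) = gtgt TG (zG (tag phi)).
    by apply: composable_zG; rewrite ?(fsrc_unit baseG).
  have ptE : ptG e' = gmul TG (ptG e) (zG (tag phi)) by rewrite ptG_cast.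
  have : vsrc E (tag phi) e' = 0.
    apply: (@ker_src _ (gsrc G (tag phi))).
    by rewrite ptE (fsrc_mul totG) // src_zG.
  rewrite -e'E (fr_split lp) linearD s0 addr0 => /sinj v0.
  exists (usubmx x) => //; apply: ptG_inj; rewrite pt_tgt_c.
  by rewrite -[X in fr _ _ X]v0 e'E ptE -inv_zG (fmulK totG).
- case=> lp s0 si [] [lt it rt] [ltb itb rtb].
  have winj w : fr phi w 0 = 0 -> w = 0.
    move=> w0; apply: it; apply: ptG_inj.
    by rewrite [LHS]pt_tgt_c [RHS]pt_tgt_c w0 fr00.
  have wsurj e : vsrc E (tag phi) e = 0 -> exists w, fr phi w 0 = e.
    move=> e0.
    have cz : gsrc TG (ptG e) = gtgt TG (zG (ginv G (tag phi))).
      by apply: composable_zG; rewrite ?(ftgt_inv baseG).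
    pose e' := castEG (mulVG (tag phi)) (Rtr (ginv G (tag phi)) e).
    have ptE : ptG e' = gmul TG (ptG e) (zG (ginv G (tag phi))) by rewrite ptG_cast.
    have : core e'.
      apply: (@ker_src _ (gtgt G (tag phi))).
      by rewrite ptE (fsrc_mul totG) // src_zG (fsrc_inv baseG).
    rewrite -[core e']/(core (x := tag (fr_tgt phi)) e') -rt => -[w _ we].
    have {}we : tgt_c phi w = e' := we.
    exists w; apply: ptG_inj; rewrite -tgt_cK // we ptE -inv_zG (fmulVK totG) // src_zG.
    by move: cz; rewrite tgt_zG (ftgt_inv baseG).
  have ssurj y : exists v, vsrc E (tag phi) (fr phi 0 v) = y.
    exact: (inj_cV_surj (linear_src_b lp) si).
  have tsurj y : exists v, vtgt E (tag phi) (fr phi 0 v) = y.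
    exact: (inj_cV_surj ltb itb).
  split; [|exact: s0|exact: Hspace_compl|exact: Hspace_compl].
  split=> //.
    apply: (lin_inj lp) => x; rewrite -(vsubmxK x) -/(fr _ _ _) => x0.
    have v0 : dsubmx x = 0.
      apply: si; rewrite /src_b fr00 // linear0.
      by have := congr1 (vsrc E (tag phi)) x0; rewrite fr_split // linearD s0 addr0 linear0.
    by move: x0; rewrite v0 => /winj ->; rewrite col_mx0.
  apply/seteqP; split=> // e _; have [v ve] := ssurj (vsrc E (tag phi) e).
  have [|w we] := wsurj (e - fr phi 0 v); first by rewrite linearB ve subrr.
  by exists (col_mx w v) => //; rewrite -/(fr _ _ _) fr_split // we addrC subrK.
Qed.

Section OneFrame.
Variable phi : preframe1 E.
Hypothesis S : sbis_frame phi.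
Let lp := sbis_linear S.
Let s0 := sbis_src0 S.

Lemma mu_tgt w : tgt_b phi (mu phi *m w) = vtgt E (tag phi) (fr phi w 0).
Proof.
apply: ptM_inj; have := mu1P (sbis_tgt S) w.
rewrite -[ptM _]/(ptM (tgt_b phi (mu phi *m w))) => ->.
rewrite -[ptG _]/(ptG (tgt_c phi w)) pt_tgt_c (ftgt_mul totG) //.
by apply: composable_zG; rewrite ?(ftgt_inv baseG).
Qed.

(** [phi(- w, d w)] is the value whose inverse, translated, defines the source
    core frame; it lies in the kernel of the target by definition of d. *)
Lemma tgt_cross w : vtgt E (tag phi) (fr phi (- w) (mu phi *m w)) = 0.
Proof.
have -> : fr phi (- w) (mu phi *m w) = fr phi 0 (mu phi *m w) - fr phi w 0.
  by rewrite -(frN lp) -(frD lp) oppr0 addr0 add0r.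
by rewrite linearB /= -mu_tgt subrr.
Qed.

Lemma pt_src w v : gsrc TG (ptG (fr phi w v)) = ptM (src_b phi v).
Proof. by congr (ptM _); rewrite /= (fr_split lp) linearD s0 addr0. Qed.

Lemma cross_src w :
  gsrc TG (ginv TG (ptG (fr phi (- w) (mu phi *m w)))) = gtgt TG (zG (tag phi)).
Proof. by rewrite (fsrc_inv totG) tgt_zG tgt_ker // tgt_cross. Qed.

Lemma sbis_inj w v : fr phi w v = 0 -> w = 0 /\ v = 0.
Proof.
have [[_ ip _] _ _ _] := (Fr_sbisP phi).2 S.
rewrite /fr -[RHS](lin0 lp) => /ip; rewrite -[RHS](col_mx0 R l k 1).
by move=> /eq_col_mx[].
Qed.

Lemma sbis_surj e : exists w v, fr phi w v = e.
Proof.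
have [[_ _ rp] _ _ _] := (Fr_sbisP phi).2 S.
have : range (tagged phi) e by rewrite rp.
by case=> x _ <-; exists (usubmx x), (dsubmx x); rewrite /fr vsubmxK.
Qed.

Lemma pt_src_mu w :
  ptM (src_b phi (mu phi *m w)) = gtgt TG (ptG (src_c phi w)).
Proof.
rewrite pt_src_c (ftgt_mul totG) ?cross_src // (ftgt_inv totG).
by rewrite pt_src.
Qed.

Lemma cast_src_c : ginv G (gmul G (gunit G (gsrc G (tag phi))) (ginv G (tag phi))) = tag phi.
Proof. by rewrite (fmul1l baseG) ?(ftgt_inv baseG) // (fginvK baseG). Qed.

(** An element e of the core at s(g) is the source core frame at [- w], where
    [phi(w, v)] is the inverse of the translate of e to the inverse of g:
    this value is in the kernel of the target, which forces [v = - d w]. *)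
Lemma frames0_src : frames0 (fr_src phi).
Proof.
split; last first.
  have ls := linear_src_b lp; split; [exact: ls|exact: sbis_src_inj S|].
  apply/seteqP; split=> // e _.
  by have [v <-] := inj_cV_surj ls (sbis_src_inj S) e; exists v.
have lc : linear (src_c phi).
  move=> a u v; apply: ptG_inj; rewrite ptG_cast.
  have -> : fr phi (- (a *: u + v)) (mu phi *m (a *: u + v)) =
      a *: fr phi (- u) (mu phi *m u) + fr phi (- v) (mu phi *m v).
    by rewrite -(linear_fr lp) scalerN opprD linearP.
  have k0 w : vsrc E _ (vinv E (tag phi) (fr phi (- w) (mu phi *m w))) = 0.
    apply: (@ker_src _ (gtgt G (tag phi))).
    by rewrite -tgt_zG -(cross_src w).
  rewrite linearP Rtr_linear ?(fsrc_inv baseG) //.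
  by apply: ptG_D; rewrite ?ptG_cast //; apply: ptG_Z; rewrite ptG_cast.
split=> //.
- apply: (lin_inj lc) => w w0.
  have /sbis_inj[+ _] : fr phi (- w) (mu phi *m w) = 0.
    apply: (@ptG_eq0 _ (tag phi)).
    have /(congr1 (fun e => ginv TG (gmul TG e (ginv TG (zG (tag phi)))))) := pt_src_c phi w.
    rewrite (fmulK totG) ?cross_src // (fginvK totG) => <-.
    rewrite w0 inv_zG mul_zG ?(fsrc_unit baseG) ?(ftgt_inv baseG) // inv_zG.
    by rewrite cast_src_c.
  by move/eqP; rewrite oppr_eq0 => /eqP.
- apply/seteqP; split=> [_ [w _ <-]|e].
    apply: (@ker_src _ (gsrc G (tag phi))).
    by rewrite pt_src_c (fsrc_mul totG) ?cross_src // src_zG.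
  rewrite /core /= => e0.
  pose f := castEG cast_src_c (vinv E _ (Rtr (ginv G (tag phi)) e)).
  have cz : gsrc TG (ptG e) = gtgt TG (zG (ginv G (tag phi))).
    by apply: composable_zG; rewrite ?(fsrc_unit baseG) ?(ftgt_inv baseG).
  have ptE : ptG f = ginv TG (gmul TG (ptG e) (zG (ginv G (tag phi)))).
    by rewrite ptG_cast.
  have f0 : vtgt E (tag phi) f = 0.
    apply: (@ker_tgt _ (gtgt G (tag phi))).
    by rewrite ptE (ftgt_inv totG) (fsrc_mul totG) // src_zG (fsrc_inv baseG).
  have [w [v fE]] := sbis_surj f.
  have vE : v = mu phi *m (- w).
    have [_ [_ itb _]] := sbis_tgt S; apply: (itb : injective (tgt_b phi)).
    rewrite mulmxN (linN (linear_tgt_b lp)) mu_tgt; apply/eqP; rewrite -subr_eq0 opprK; apply/eqP.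
    by rewrite /tgt_b -linearD -(frD lp) add0r addr0 fE.
  exists (- w) => //; apply: ptG_inj; rewrite pt_src_c opprK -vE fE ptE (fginvK totG).
  by rewrite -inv_zG (fmulVK totG) // cz tgt_zG src_zG (ftgt_inv baseG).
Qed.

(** The moment is constant along arrows of the groupoid of frames. *)
Lemma mu_src : mu phi = mu1 (fr_src phi).
Proof. by apply/esym/mu1_uniq; [exact: frames0_src|exact: pt_src_mu]. Qed.

End OneFrame.

(** * The groupoid of frames *)

Section Composable.
Variables phi psi : preframe1 E.
Hypotheses (S : sbis_frame phi) (T : sbis_frame psi).
Hypothesis st : fr_src phi = fr_tgt psi.

Lemma comp_base : gsrc G (tag phi) = gtgt G (tag psi).
Proof. exact: (congr1 (fun p : preframe0 E => tag p) st). Qed.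

Lemma comp_b v : ptM (src_b phi v) = gtgt TG (ptG (fr psi 0 v)).
Proof. exact: (congr1 (fun p : preframe0 E => ptM ((tagged p).2 v)) st). Qed.

Lemma comp_c w : ptG (src_c phi w) = ptG (tgt_c psi w).
Proof. exact: (congr1 (fun p : preframe0 E => ptG ((tagged p).1 w)) st). Qed.

Lemma comp_mu : mu phi = mu psi.
Proof. by rewrite (mu_src S) st. Qed.

Lemma comp_fr w v : gsrc TG (ptG (fr phi w v)) = gtgt TG (ptG (fr psi 0 v)).
Proof. by rewrite pt_src // comp_b. Qed.

Lemma comp_zG : gsrc TG (zG (tag phi)) = gtgt TG (zG (tag psi)).
Proof. by rewrite src_zG tgt_zG comp_base. Qed.

(** Interchange applied to [phi(w, v) = phi(0, v) + phi(w, 0)] and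
    [psi(0, v) = psi(0, v) + 0]. *)
Lemma fr_mul_vmul w v : fr (fr_mul phi psi) w v = vmul E (fr phi w v) (fr psi 0 v).
Proof.
rewrite fr_mulE (fr_split (sbis_linear S) w v) -[in RHS](addr0 (fr psi 0 v)).
rewrite vmulD //; first exact: comp_fr.
by rewrite src_ker ?sbis_src0 // comp_base tgt_zG.
Qed.

Lemma pt_fr_mul w v : ptG (fr (fr_mul phi psi) w v) =
  gmul TG (ptG (fr phi w v)) (ptG (fr psi 0 v)).
Proof. by rewrite fr_mul_vmul. Qed.

(** Naturality: [psi(y, 0)] is the translate of the target core frame of [psi],
    which is the source core frame of [phi], that is the translated inverse of
    [phi(- y, d y)]. *)
Lemma exchange y : gmul TG (ptG (fr phi (- y) (mu phi *m y))) (ptG (fr psi y 0)) =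
  zG (gmul G (tag phi) (tag psi)).
Proof.
rewrite -(tgt_cK (sbis_src0 T y)) -comp_c pt_src_c.
rewrite (fmulA totG) ?cross_src //; last exact: comp_zG.
rewrite mul_zG ?comp_base // (fmulKl totG) //.
by rewrite (tgt_ker (tgt_cross S y)) tgt_zG (ftgt_mul baseG) // comp_base.
Qed.

Lemma comp_cross y :
  gsrc TG (ptG (fr phi (- y) (mu phi *m y))) = gtgt TG (ptG (fr psi y 0)).
Proof.
rewrite comp_fr; congr (ptM _).
by rewrite /= comp_mu -[LHS]/(tgt_b psi _) mu_tgt.
Qed.

Lemma comp_zG_cross y :
  gsrc TG (zG (tag phi)) = gtgt TG (ptG (fr psi (- y) (mu psi *m y))).
Proof. by rewrite src_zG (tgt_ker (tgt_cross T y)) comp_base. Qed.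

(** Split [psi(0, d y) = psi(y, 0) + psi(- y, d y)]; the first summand is killed
    by [exchange]. *)
Lemma fr_mul_cross y : ptG (fr (fr_mul phi psi) (- y) (mu phi *m y)) =
  gmul TG (zG (tag phi)) (ptG (fr psi (- y) (mu psi *m y))).
Proof.
rewrite fr_mul_vmul -[fr phi _ _]addr0.
have -> : fr psi 0 (mu phi *m y) = fr psi y 0 + fr psi (- y) (mu psi *m y).
  by rewrite -(frD (sbis_linear T)) subrr add0r comp_mu.
rewrite vmulD; [|exact: comp_cross|exact: comp_zG_cross].
by rewrite (ptG_eq0 (exchange y)) add0r.
Qed.

Lemma fr_tgt_mul : fr_tgt (fr_mul phi psi) = fr_tgt phi.
Proof.
apply: frame0_eq => [w|v].
- rewrite -[LHS]/(ptG (tgt_c (fr_mul phi psi) w)) -[RHS]/(ptG (tgt_c phi w)).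
  rewrite !pt_tgt_c pt_fr_mul (fr00 (sbis_linear T)).
  have cz : gsrc TG (ptG (fr phi w 0)) = gtgt TG (zG (tag psi)).
    by apply: composable_zG; rewrite ?comp_base ?sbis_src0.
  have gh := ftgt_inv baseG (gmul G (tag phi) (tag psi)).
  rewrite (fmulA totG) //; last first.
    by rewrite src_zG tgt_zG gh (fsrc_mul baseG) // comp_base.
  rewrite mul_zG; last by rewrite gh (fsrc_mul baseG) // comp_base.
  rewrite (fginv_mul baseG) ?comp_base // (fmulKl baseG) //.
  by rewrite (ftgt_inv baseG) comp_base.
- rewrite -[LHS]/(gtgt TG (ptG (fr (fr_mul phi psi) 0 v))) pt_fr_mul.
  by rewrite (ftgt_mul totG) // comp_fr.
Qed.

Lemma mu_mul : mu (fr_mul phi psi) = mu phi.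
Proof. by rewrite /mu fr_tgt_mul. Qed.

Lemma fr_src_mul : fr_src (fr_mul phi psi) = fr_src psi.
Proof.
apply: frame0_eq => [w|v].
- rewrite -[LHS]/(ptG (src_c (fr_mul phi psi) w)) -[RHS]/(ptG (src_c psi w)).
  rewrite !pt_src_c mu_mul fr_mul_cross (fginv_mul totG (comp_zG_cross w)).
  rewrite inv_zG (fmulA totG).
  + rewrite mul_zG; last by rewrite (fsrc_inv baseG) (ftgt_mul baseG) // comp_base.
    by rewrite (fmulVKl baseG) // comp_base.
  + by rewrite (fsrc_inv totG) (tgt_ker (tgt_cross T w)) tgt_zG (ftgt_inv baseG) comp_base.
  + by rewrite src_zG tgt_zG (fsrc_inv baseG) (ftgt_mul baseG) // comp_base.
- rewrite -[LHS]/(gsrc TG (ptG (fr (fr_mul phi psi) 0 v))) pt_fr_mul.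
  by rewrite (fsrc_mul totG) // comp_fr.
Qed.

Lemma sbis_mul : sbis_frame (fr_mul phi psi).
Proof.
split.
- apply: linear_of_fr => a w w' v v'; rewrite !fr_mul_vmul (linear_fr (sbis_linear S)).
  rewrite (linear_fr0 (sbis_linear T)).
  by apply: vmul_linear; [exact: comp_base|exact: comp_fr|exact: comp_fr].
- move=> w; apply: (@ker_src _ (gsrc G (tag psi))).
  rewrite pt_fr_mul (fsrc_mul totG) ?comp_fr // (fr00 (sbis_linear T)).
  exact: src_zG.
- move=> u v uv; apply: (sbis_src_inj T); apply: ptM_inj.
  have : gsrc TG (ptG (fr (fr_mul phi psi) 0 u)) = gsrc TG (ptG (fr (fr_mul phi psi) 0 v)).
    exact: (congr1 (fun x => ptM x) uv).
  by rewrite !pt_fr_mul !(fsrc_mul totG) ?comp_fr // !pt_src.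
- by rewrite fr_tgt_mul; apply: sbis_tgt S.
Qed.

End Composable.

Section Unit.
Variables (x : Mtype E) (c : 'cV[R]_l -> EG E (gunit G x)) (b : 'cV[R]_k -> EM E x).
Let p := mkframe0 c b.
Hypothesis F : frames0 p.

Let lc : linear c. Proof. by have [[]] := F. Qed.
Let lb : linear b. Proof. by have [_ []] := F. Qed.
Let c0 w : vsrc E (gunit G x) (c w) = 0.
Proof.
have [[_ _ rc] _] := F; have {}rc : range c = @core R l k E x := rc.
by suff : core (c w) by []; rewrite -rc; exists w.
Qed.

Let fr_unit0 v : fr (fr_unit p) 0 v = vunit E x (b v).
Proof. by rewrite fr_unitE /= (lin0 lc) addr0. Qed.

Let fr_unitw w : fr (fr_unit p) w 0 = c w.
Proof. by rewrite fr_unitE /= (lin0 lb) linear0 add0r. Qed.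

Let comp_c_zG w : gsrc TG (ptG (c w)) = gtgt TG (zG (gunit G x)).
Proof. by apply: composable_zG; rewrite // (fsrc_unit baseG) (ftgt_unit baseG). Qed.

Let mul_c_zG w : gmul TG (ptG (c w)) (zG (gunit G x)) = ptG (c w).
Proof. by rewrite -unit_zM (fmul1r totG) // src_ker // (fsrc_unit baseG). Qed.

Lemma fr_tgt_unit : fr_tgt (fr_unit p) = p.
Proof.
have invu : ginv G (gunit G x) = gunit G x.
  apply/esym/(@ginv_uniq _ _ (full_gpd G) baseG) => //=.
    by rewrite (fsrc_unit baseG) (ftgt_unit baseG).
  by rewrite (ftgt_unit baseG) (fmul1l baseG) // (ftgt_unit baseG).
apply: frame0_eq => [w|v].
- rewrite -[LHS]/(ptG (tgt_c (fr_unit p) w)) pt_tgt_c fr_unitw.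
  by rewrite -[tag _]/(gunit G x) invu mul_c_zG.
- rewrite -[LHS]/(gtgt TG (ptG (fr (fr_unit p) 0 v))) fr_unit0.
  exact: (ftgt_unit totG (ptM (b v))).
Qed.

Lemma mu_unit : mu (fr_unit p) = mu1 p.
Proof. by rewrite /mu fr_tgt_unit. Qed.

Lemma sbis_unit : sbis_frame (fr_unit p).
Proof.
split.
- apply: linear_of_fr => a w w' v v'; rewrite !fr_unitE /= lc lb linearP.
  by rewrite scalerDr addrACA.
- by move=> w; rewrite fr_unitw.
- move=> u v uv; have [_ [_ ib _]] := F; apply: (ib : injective b); apply: ptM_inj.
  rewrite -[LHS](fsrc_unit totG) -[RHS](fsrc_unit totG).
  have := congr1 (fun x => ptM x) uv; rewrite /src_b.
  rewrite -[X in X = _]/(gsrc TG (ptG (fr (fr_unit p) 0 u))).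
  rewrite -[X in _ = X]/(gsrc TG (ptG (fr (fr_unit p) 0 v))).
  by rewrite !fr_unit0.
- by rewrite fr_tgt_unit.
Qed.

Lemma fr_src_unit : fr_src (fr_unit p) = p.
Proof.
apply: frame0_eq => [w|v]; last first.
  rewrite -[LHS]/(gsrc TG (ptG (fr (fr_unit p) 0 v))) fr_unit0.
  exact: (fsrc_unit totG (ptM (b v))).
rewrite -[LHS]/(ptG (src_c (fr_unit p) w)) pt_src_c.
set e := fr _ _ _; set d := mu _ in e *.
have dw : ptM (b (d *m w)) = gtgt TG (ptG (c w)).
  by rewrite /d mu_unit -(mu1P F w).
have eE : e = vunit E x (b (d *m w)) - c w.
  by rewrite /e fr_unitE /= (linN lc).
have s1 : gsrc TG (ptG (vunit E x (b (d *m w)))) = gtgt TG (ptG (c w)).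
  by rewrite -dw; exact: (fsrc_unit totG (ptM _)).
have s2 : gsrc TG (ptG (- c w)) = gtgt TG (zG (gunit G x)).
  by rewrite -(linN lc); exact: comp_c_zG.
(* e . c(w) = 1_b(dw) . c(w) - c(w) . 0 = 0, so that the inverse of e is c(w) *)
have ec : gmul TG (ptG e) (ptG (c w)) = zG (gunit G x).
  rewrite eE -{2}(addr0 (c w)).
  rewrite -[LHS]/(ptG (vmul E _ _)) vmulD //.
  have -> : zG (gunit G x) = ptG (c w + - c w) by rewrite subrr.
  apply: ptG_D; last by rewrite -(linN lc); exact: mul_c_zG.
  exact: (fmul1l totG dw).
rewrite -[tag _]/(gunit G x) -ec (fmulVKl totG) //.
rewrite -dw (pt_src sbis_unit) -[LHS]/(gsrc TG (ptG (fr (fr_unit p) 0 (d *m w)))).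
by rewrite fr_unit0; exact: (fsrc_unit totG (ptM _)).
Qed.

End Unit.

Section Inverse.
Variable phi : preframe1 E.
Hypothesis S : sbis_frame phi.
Let lp := sbis_linear S.

Lemma fr_inv0 v : fr (fr_inv phi) 0 v = vinv E (tag phi) (fr phi 0 v).
Proof. by rewrite fr_invE oppr0 mulmx0 addr0. Qed.

Lemma fr_invw w :
  fr (fr_inv phi) w 0 = vinv E (tag phi) (fr phi (- w) (mu phi *m w)).
Proof. by rewrite fr_invE add0r. Qed.

Lemma pt_fr_inv w v :
  ptG (fr (fr_inv phi) w v) = ginv TG (ptG (fr phi (- w) (v + mu phi *m w))).
Proof. by rewrite fr_invE. Qed.

Lemma fr_tgt_inv : fr_tgt (fr_inv phi) = fr_src phi.
Proof.
apply: frame0_eq => [w|v].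
- rewrite -[LHS]/(ptG (tgt_c (fr_inv phi) w)) -[RHS]/(ptG (src_c phi w)).
  rewrite pt_tgt_c pt_src_c fr_invw -[tag (fr_inv phi)]/(ginv G (tag phi)).
  by rewrite (fginvK baseG).
- rewrite -[LHS]/(gtgt TG (ptG (fr (fr_inv phi) 0 v))) fr_inv0.
  exact: (ftgt_inv totG (ptG (fr phi 0 v))).
Qed.

Lemma mu_inv : mu (fr_inv phi) = mu phi.
Proof. by rewrite [LHS]/mu fr_tgt_inv -mu_src. Qed.

Lemma fr_src_inv : fr_src (fr_inv phi) = fr_tgt phi.
Proof.
apply: frame0_eq => [w|v].
- rewrite -[LHS]/(ptG (src_c (fr_inv phi) w)) -[RHS]/(ptG (tgt_c phi w)).
  rewrite pt_tgt_c pt_src_c pt_fr_inv mu_inv (fginvK totG).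
  by rewrite mulmxN subrr opprK.
- rewrite -[LHS]/(gsrc TG (ptG (fr (fr_inv phi) 0 v))) fr_inv0.
  exact: (fsrc_inv totG (ptG (fr phi 0 v))).
Qed.

Lemma sbis_inv : sbis_frame (fr_inv phi).
Proof.
split.
- apply: linear_of_fr => a w w' v v'; rewrite !fr_invE -linearP -(linear_fr lp).
  by congr (vinv E _ (fr phi _ _)); rewrite linearP /= ?scalerDr ?scalerN ?opprD // addrACA.
- move=> w; apply: (@ker_src _ (gtgt G (tag phi))).
  by rewrite fr_invw (cross_src S) tgt_zG.
- move=> u v uv; have [_ [_ it _]] := sbis_tgt S; apply: (it : injective (tgt_b phi)).
  apply: ptM_inj; have := congr1 (fun x => ptM x) uv; rewrite /src_b !fr_inv0.
  rewrite -[X in X = _]/(gsrc TG (ginv TG (ptG (fr phi 0 u)))).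
  rewrite -[X in _ = X]/(gsrc TG (ginv TG (ptG (fr phi 0 v)))).
  by rewrite !(fsrc_inv totG).
- by rewrite fr_tgt_inv; apply: frames0_src.
Qed.

End Inverse.

Lemma src_c0 phi : sbis_frame phi -> src_c phi 0 = 0.
Proof. by move=> S; have [[lc _ _] _] := frames0_src S; exact: (lin0 lc). Qed.

Lemma fr_mulV phi : sbis_frame phi -> fr_mul phi (fr_inv phi) = fr_unit (fr_tgt phi).
Proof.
move=> S; have T := sbis_inv S; have st : fr_src phi = fr_tgt (fr_inv phi).
  by rewrite fr_tgt_inv.
apply: frame1_eq => w v; rewrite fr_mulE fr_unitE fr_inv0.
apply: ptG_D; last by rewrite -[RHS]/(ptG (tgt_c phi w)) pt_tgt_c.
exact: (fmulV totG (ptG (fr phi 0 v))).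
Qed.

Lemma fr_mulVl phi : sbis_frame phi -> fr_mul (fr_inv phi) phi = fr_unit (fr_src phi).
Proof.
move=> S; apply: frame1_eq => w v; rewrite fr_mulE fr_unitE fr_inv0 fr_invw.
apply: ptG_D; last by rewrite -[RHS]/(ptG (src_c phi w)) pt_src_c.
exact: (fmulVl totG (ptG (fr phi 0 v))).
Qed.

Lemma fr_mul1l phi : sbis_frame phi -> fr_mul (fr_unit (fr_tgt phi)) phi = phi.
Proof.
move=> S; apply: frame1_eq => w v; rewrite fr_mulE (fr_split (sbis_linear S) w v).
have F := sbis_tgt S; have [[lc _ _] [lb _ _]] := F.
rewrite !fr_unitE (lin0 lc) (lin0 lb) addr0 linear0 add0r.
apply: ptG_D; last exact: (tgt_cK (sbis_src0 S w)).
exact: (fmul1l totG (erefl (gtgt TG (ptG (fr phi 0 v))))).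
Qed.

Lemma fr_mul1r phi : sbis_frame phi -> fr_mul phi (fr_unit (fr_src phi)) = phi.
Proof.
move=> S; have F := frames0_src S.
have T := sbis_unit F; have st := fr_tgt_unit F.
apply: frame1_eq => w v; have u0 : fr (fr_unit (fr_src phi)) 0 v = vunit E (gsrc G (tag phi)) (src_b phi v).
  by rewrite fr_unitE (src_c0 S : (tagged (fr_src phi)).1 0 = 0) addr0.
rewrite (pt_fr_mul S (esym st)) u0.
apply: (fmul1r totG (x := ptM (src_b phi v))); exact/esym/pt_src.
Qed.

Lemma fr_mulA phi psi chi : sbis_frame phi -> sbis_frame psi -> sbis_frame chi ->
  fr_src phi = fr_tgt psi -> fr_src psi = fr_tgt chi ->
  fr_mul (fr_mul phi psi) chi = fr_mul phi (fr_mul psi chi).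
Proof.
move=> S T U st tu; apply: frame1_eq => w v.
have sm := sbis_mul S T st; have tm := sbis_mul T U tu.
rewrite (pt_fr_mul sm) ?(fr_src_mul S T st) // (pt_fr_mul S st).
rewrite (pt_fr_mul S) ?(fr_tgt_mul T U tu) // (pt_fr_mul T tu).
by apply: (fmulA totG); apply: comp_fr.
Qed.

Lemma gpd_Fr_sbis : is_groupoid (Fr_sbis_gpd E).
Proof.
split => /=.
- by move=> phi /Fr_sbisP /frames0_src.
- by move=> phi /Fr_sbisP /sbis_tgt.
- by move=> phi psi /Fr_sbisP S /Fr_sbisP T st; apply/Fr_sbisP/sbis_mul.
- by move=> [x [c b]] F; apply/Fr_sbisP/sbis_unit.
- by move=> phi /Fr_sbisP S; apply/Fr_sbisP/sbis_inv.
- by move=> phi psi /Fr_sbisP S /Fr_sbisP T st; apply: fr_src_mul.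
- by move=> phi psi /Fr_sbisP S /Fr_sbisP T st; apply: fr_tgt_mul.
- by move=> phi psi chi /Fr_sbisP S /Fr_sbisP T /Fr_sbisP U; apply: fr_mulA.
- by move=> [x [c b]] F; apply: fr_src_unit.
- by move=> [x [c b]] F; apply: fr_tgt_unit.
- by move=> phi /Fr_sbisP; apply: fr_mul1l.
- by move=> phi /Fr_sbisP; apply: fr_mul1r.
- by move=> phi /Fr_sbisP; apply: fr_src_inv.
- by move=> phi _; apply: fr_tgt_inv.
- by move=> phi /Fr_sbisP; apply: fr_mulV.
- by move=> phi /Fr_sbisP; apply: fr_mulVl.
Qed.

(** * The actions *)

Lemma frames0_act p h : frames0 p -> @GL1_set R l k h -> frames0 (fr_act1 p h).
Proof. by move=> [Fc Fb] [uA uB]; split; apply: is_frame_precomp. Qed.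

Lemma mu1_act p h : frames0 p -> GL1_set h -> mu1 p = gtgt (GL_ops10 R l k) h ->
  mu1 (fr_act1 p h) = gsrc (GL_ops10 R l k) h.
Proof.
case: h => [[d A] B] F H /= dE; have [/= uA uB] := H.
apply: mu1_uniq; first exact: frames0_act.
move=> w; rewrite /= /precomp -!mulmxA mulKVmx // -dE.
exact: mu1P.
Qed.

Lemma fr_act1_mul p h h' :
  fr_act1 (fr_act1 p h) h' = fr_act1 p (gmul (GL_ops10 R l k) h h').
Proof. by rewrite /fr_act1 /= !precompM. Qed.

Lemma fr_act1_unit p d : fr_act1 p (gunit (GL_ops10 R l k) d) = p.
Proof. by case: p => x [c b]; rewrite /fr_act1 /= !precomp1. Qed.

Lemma act1_GL10 : right_action (H10 (GL_two_gpd R l k)) (@frames0 R l k E)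
  (@mu1 R l k E) (@fr_act1 R l k E).
Proof.
split=> //.
- by move=> p h F H _; apply: frames0_act.
- by move=> p h; apply: mu1_act.
- by move=> p _; apply: fr_act1_unit.
- by move=> p h h' _ _ _ _ _; apply: fr_act1_mul.
Qed.

Lemma free_act1 : free_action (H10 (GL_two_gpd R l k)) (@frames0 R l k E)
  (@mu1 R l k E) (@fr_act1 R l k E).
Proof.
move=> p [[d A] B] [[_ ic _] [_ ib _]] _ /= -> act.
have -> : A = 1%:M.
  apply: (precomp_free ic) => w; apply: ptG_inj.
  exact: (congr1 (fun p : preframe0 E => ptG ((tagged p).1 w)) act).
have -> // : B = 1%:M.
apply: (precomp_free ib) => v; apply: ptM_inj.
exact: (congr1 (fun p : preframe0 E => ptM ((tagged p).2 v)) act).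
Qed.

Lemma fr_act2E phi d A J B w v :
  fr (fr_act2 phi (gl2 d A J B)) w v = fr phi (A *m w + J *m (B *m v)) (B *m v).
Proof. by rewrite /fr /= /precomp mul_block_col mul0mx add0r !mulmxA. Qed.

Lemma pt_tgt phi w v : sbis_frame phi ->
  gtgt TG (ptG (fr phi w v)) = ptM (tgt_b phi (v + mu phi *m w)).
Proof.
move=> S; rewrite (linD (linear_tgt_b (sbis_linear S))) (mu_tgt S) -linearD.
by rewrite -(fr_split (sbis_linear S)).
Qed.

Section OneFrameAct.
Variables (phi : preframe1 E) (A : 'M[R]_l) (J : 'M[R]_(l, k)) (B : 'M[R]_k).
Hypotheses (S : sbis_frame phi) (uA : A \in unitmx) (uB : B \in unitmx).
Let d := mu phi.
Hypothesis uJ : 1%:M + J *m d \in unitmx.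
Let h := gl2 d A J B.
Let A' := invmx (1%:M + J *m d) *m A.
Let lp := sbis_linear S.

Let GL2_h : GL2_set h. Proof. exact: GL2_gl2. Qed.

Let mulA_split (w : 'cV[R]_l) : A *m w = A' *m w + J *m (d *m (A' *m w)).
Proof.
have {1}-> : A = A' + J *m (d *m A').
  by rewrite -[LHS](mulKVmx uJ) mulmxDl mul1mx -mulmxA.
by rewrite mulmxDl !mulmxA.
Qed.

Lemma fr_act2w w : fr (fr_act2 phi h) w 0 = fr phi (A *m w) 0.
Proof. by rewrite fr_act2E !mulmx0 addr0. Qed.

(** The twist [1 + d J] in the target 1-arrow is the contribution of the core
    part: the target of [phi(J B v, B v)] is [t(phi)^b (B v + d J B v)]. *)
Lemma fr_tgt_act : fr_tgt (fr_act2 phi h) =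
  fr_act1 (fr_tgt phi) (gtgt (GL_ops21 R l k) h).
Proof.
rewrite tgt21_gl2 //; apply: frame0_eq => [w|v].
- rewrite -[LHS]/(ptG (tgt_c (fr_act2 phi h) w)) -[RHS]/(ptG (tgt_c phi (A *m w))).
  by rewrite !pt_tgt_c fr_act2w.
- rewrite -[LHS]/(ptM (vtgt E (tag phi) (fr (fr_act2 phi h) 0 v))).
  rewrite -[RHS]/(ptM (tgt_b phi ((1%:M + d *m J) *m B *m v))); congr (ptM _).
  apply: ptM_inj; rewrite fr_act2E mulmx0 add0r -[LHS]/(gtgt TG (ptG (fr phi (J *m (B *m v)) (B *m v)))) pt_tgt // -/d.
  by rewrite !mulmxDl mul1mx !mulmxA.
Qed.

Lemma mu_act : mu (fr_act2 phi h) = gsrc (GL_ops20 R l k) h.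
Proof.
rewrite /mu fr_tgt_act mu1_act //; first exact: sbis_tgt S.
exact: GL21_tgt_in.
Qed.

Lemma Bmu_act (w : 'cV[R]_l) : B *m (mu (fr_act2 phi h) *m w) = d *m (A' *m w).
Proof. by rewrite mu_act src20_gl2 // -/A' -!mulmxA mulKVmx. Qed.

(** As [B d' = d A'], the first component is [- A w + J d A' w = - A' w]. *)
Lemma fr_act2_cross w :
  fr (fr_act2 phi h) (- w) (mu (fr_act2 phi h) *m w) =
  fr phi (- (A' *m w)) (d *m (A' *m w)).
Proof.
rewrite fr_act2E Bmu_act mulmxN.
suff -> : - (A *m w) + J *m (d *m (A' *m w)) = - (A' *m w) by [].
by rewrite mulA_split opprD subrK.
Qed.

Lemma fr_src_act : fr_src (fr_act2 phi h) =
  fr_act1 (fr_src phi) (gsrc (GL_ops21 R l k) h).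
Proof.
rewrite src21_gl2 //; apply: frame0_eq => [w|v].
- rewrite -[LHS]/(ptG (src_c (fr_act2 phi h) w)) -[RHS]/(ptG (src_c phi (A' *m w))).
  by rewrite !pt_src_c fr_act2_cross.
- rewrite -[LHS]/(gsrc TG (ptG (fr (fr_act2 phi h) 0 v))) fr_act2E mulmx0 add0r.
  exact: pt_src.
Qed.

Lemma sbis_act : sbis_frame (fr_act2 phi h).
Proof.
split.
- by move=> a u v; rewrite /= /precomp linearP lp.
- by move=> w; rewrite fr_act2w; exact: (sbis_src0 S (A *m w)).
- move=> u v uv; have : B *m u = B *m v.
    apply: (sbis_src_inj S); apply: ptM_inj.
    rewrite -(pt_src S (J *m (B *m u))) -(pt_src S (J *m (B *m v))).
    have := congr1 (fun x => ptM x) uv.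
    rewrite -[X in X = _]/(gsrc TG (ptG (fr (fr_act2 phi h) 0 u))).
    rewrite -[X in _ = X]/(gsrc TG (ptG (fr (fr_act2 phi h) 0 v))).
    by rewrite !fr_act2E mulmx0 !add0r.
  by move=> /(congr1 (mulmx (invmx B))); rewrite !mulKmx.
- rewrite fr_tgt_act; apply: frames0_act; [exact: sbis_tgt|exact: GL21_tgt_in].
Qed.

Lemma fr_inv_act : fr_act2 (fr_inv phi) (ginv (GL_ops21 R l k) h) =
  fr_inv (fr_act2 phi h).
Proof.
rewrite GL21_inv //; apply: frame1_eq => w v; rewrite fr_act2E !fr_invE.
rewrite fr_act2E [B *m (_ + _)]mulmxDr Bmu_act -/A' -/d.
have JE : invmx (1%:M + J *m d) *m J *m (1%:M + d *m J) = J.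
  by rewrite -mulmxA mul_1Jd_r mulKmx.
have -> : - (invmx (1%:M + J *m d) *m J) *m ((1%:M + d *m J) *m B *m v) =
    - (J *m (B *m v)).
  by rewrite mulNmx !mulmxA JE.
set x := A' *m w; set y := B *m v.
have -> : - (x - J *m y) = A *m - w + J *m (y + d *m x).
  rewrite opprB mulmxN mulA_split -/x mulmxDr opprD.
  by rewrite [J *m y + J *m _]addrC addrA subrK addrC.
have -> // : (1%:M + d *m J) *m B *m v + d *m (x - J *m y) = y + d *m x.
by rewrite -mulmxA -/y mulmxDl mul1mx mulmxBr -mulmxA addrA addrAC addrK.
Qed.

End OneFrameAct.

Lemma fr_unit_act p a : frames0 p ->
  fr_act2 (fr_unit p) (gunit (GL_ops21 R l k) a) = fr_unit (fr_act1 p a).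
Proof.
case: a => [[d A] B] F; apply: frame1_eq => w v.
by rewrite fr_act2E !fr_unitE mul0mx addr0.
Qed.

(** With [u = B v] and [y = J' u], the left-hand side is
    [phi(z + y, u) . psi(0, u)] and the right-hand side
    [phi(z, u + d y) . psi(y, u)]; by interchange they differ by
    [phi(y, - d y) . psi(- y, 0) = 0]. *)
Lemma fr_mul_act phi psi h h' : sbis_frame phi -> sbis_frame psi ->
  fr_src phi = fr_tgt psi -> GL2_set h -> GL2_set h' ->
  mu phi = gtgt (GL_ops20 R l k) h ->
  gsrc (GL_ops21 R l k) h = gtgt (GL_ops21 R l k) h' ->
  fr_act2 (fr_mul phi psi) (gmul (GL_ops21 R l k) h h') =
  fr_mul (fr_act2 phi h) (fr_act2 psi h').
Proof.
move=> S T st H H' dE hh'.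
have [d [A [J [J' [B [hE hE' [uA uB] uJ uJ']]]]]] := GL21_composable H H' hh'.
have {}dE : mu phi = d by rewrite dE hE.
have dE' : mu psi = d by rewrite -(comp_mu S st).
subst d; have uB' : (1%:M + mu phi *m J') *m B \in unitmx.
  by rewrite unitmx_mul unitmx_1Jd uJ'.
have uA' : invmx (1%:M + J *m mu phi) *m A \in unitmx.
  by rewrite unitmx_mul unitmx_inv uJ.
rewrite hE hE' gl2_mul21 //.
have S' := sbis_act S uA uB' uJ.
have T' : sbis_frame (fr_act2 psi h').
  by rewrite hE' -dE'; apply: sbis_act; rewrite ?dE'.
have st' : fr_src (fr_act2 phi h) = fr_tgt (fr_act2 psi h').
  by rewrite hE fr_src_act // hE' -dE' fr_tgt_act ?dE' // st -hE -hE' hh'.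
rewrite hE hE' in T' st'.
apply: frame1_eq => w v; rewrite fr_act2E (pt_fr_mul S st) (pt_fr_mul S' st').
rewrite !fr_act2E mulmx0 add0r.
set u := B *m v; set y := J' *m u.
have -> : (1%:M + mu phi *m J') *m B *m v = u + mu phi *m y.
  by rewrite -mulmxA mulmxDl mul1mx -mulmxA.
have -> : A *m w + (J *m mu phi *m J' + J + J') *m u =
    (A *m w + J *m (u + mu phi *m y)) + y.
  by rewrite !mulmxDl mulmxDr -!mulmxA -/y [J *m (mu phi *m y) + _]addrC !addrA.
set z := A *m w + _.
have -> : fr phi (z + y) u = fr phi z (u + mu phi *m y) + fr phi (- - y) (mu phi *m (- y)).
  by rewrite -(frD (sbis_linear S)) opprK mulmxN addrK.
have -> : fr psi 0 u = fr psi y u + fr psi (- y) 0.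
  by rewrite -(frD (sbis_linear T)) subrr addr0.
rewrite -[LHS]/(ptG (vmul E _ _)) vmulD.
- by rewrite (ptG_eq0 (exchange S T st (- y))) addr0.
- by rewrite pt_src // (comp_b st) !pt_tgt // mulmx0 addr0 (comp_mu S st).
- exact: (comp_cross S T st (- y)).
Qed.

Lemma GL2_actP phi h : GL2_set h -> mu phi = gtgt (GL_ops20 R l k) h ->
  exists A J B, [/\ h = gl2 (mu phi) A J B, A \in unitmx, B \in unitmx
                  & 1%:M + J *m mu phi \in unitmx].
Proof. by move=> /GL2_setP[d [A [J [B [-> uA uB uJ]]]]] /= dE; subst d; exists A, J, B. Qed.

Lemma act2_GL20 : right_action (H20 (GL_two_gpd R l k)) (@Fr_sbis R l k E)
  (@mu R l k E) (@fr_act2 R l k E).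
Proof.
split=> //.
- move=> phi h /Fr_sbisP S H /(GL2_actP H)[A [J [B [-> uA uB uJ]]]].
  exact/Fr_sbisP/sbis_act.
- move=> phi h /Fr_sbisP S H /(GL2_actP H)[A [J [B [-> uA uB uJ]]]].
  exact: mu_act.
- by move=> [g phi] _; rewrite /fr_act2 /= precomp1.
- by move=> phi h h' _ _ _ _ _; rewrite /fr_act2 /= precompM.
Qed.

Lemma free_act2 : free_action (H20 (GL_two_gpd R l k)) (@Fr_sbis R l k E)
  (@mu R l k E) (@fr_act2 R l k E).
Proof.
move=> phi [d M] [[_ iphi _] _ _ _] _ /= -> act.
have -> // : M = 1%:M.
apply: (precomp_free iphi) => x; apply: ptG_inj.
exact: (congr1 (fun phi : preframe1 E => ptG (tagged phi x)) act).
Qed.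

Lemma two_action_Fr_sbis : right_two_action (GL_two_gpd R l k) (Fr_sbis_gpd E)
    (@mu1 R l k E) (@mu R l k E) (@fr_act1 R l k E) (@fr_act2 R l k E).
Proof.
split.
- exact: two_groupoid_GL.
- exact: gpd_Fr_sbis.
- exact: act1_GL10.
- exact: act2_GL20.
- by move=> phi /Fr_sbisP S; apply: mu_src.
- by [].
split.
- by move=> [p h] [/= F H pE]; apply: frames0_act.
- by move=> [phi h] [/= F H phiE]; apply: (act_in act2_GL20).
- move=> [phi h] [/= /Fr_sbisP S H /(GL2_actP H)[A [J [B [hE uA uB uJ]]]]].
  change (fr_src (fr_act2 phi h) = fr_act1 (fr_src phi) (gsrc (GL_ops21 R l k) h)).
  by rewrite hE fr_src_act.
- move=> [phi h] [/= /Fr_sbisP S H /(GL2_actP H)[A [J [B [hE uA uB uJ]]]]].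
  change (fr_tgt (fr_act2 phi h) = fr_act1 (fr_tgt phi) (gtgt (GL_ops21 R l k) h)).
  by rewrite hE fr_tgt_act.
- move=> [phi h] [psi h'] [/Fr_sbisP S H dE] [/Fr_sbisP T H' _] st.
  exact: (fr_mul_act S T (congr1 fst st) H H' dE (congr1 snd st)).
- by move=> [p h] [/= F H _]; apply: fr_unit_act.
- move=> [phi h] [/= /Fr_sbisP S H /(GL2_actP H)[A [J [B [hE uA uB uJ]]]]].
  change (fr_act2 (fr_inv phi) (ginv (GL_ops21 R l k) h) = fr_inv (fr_act2 phi h)).
  rewrite hE.
  exact: fr_inv_act.
Qed.

End Total.

Theorem theorem4p12 (R : realType) (l k : nat) (E : vb_groupoid R l k) :
  right_two_action (GL_two_gpd R l k) (Fr_sbis_gpd E)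
    (@mu1 R l k E) (@mu R l k E) (@fr_act1 R l k E) (@fr_act2 R l k E) /\
  free_two_action (GL_two_gpd R l k) (Fr_sbis_gpd E)
    (@mu1 R l k E) (@mu R l k E) (@fr_act1 R l k E) (@fr_act2 R l k E).
Proof.
split; first exact: two_action_Fr_sbis.
by split; [exact: free_act1|exact: free_act2].
Qed.
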